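(* Cardinality-Constrained Cluster Deletion admits an algorithm running in time $2^{k}\cdot n^{\mathcal{O}(1)}$, where $n$ is the number of vertices of the input graph.
   Context: All graphs are finite and simple. A cluster graph is a graph in which every connected component is a clique. For integers $\gamma_1,\gamma_2\ge1$, a graph is $(\gamma_1,\gamma_2)$-cardinality-constrained if every connected component $H$ satisfies $\gamma_1\le|V(H)|\le\gamma_2$. Cardinality-Constrained Cluster Deletion: given a graph $G$ and non-negative integers $\gamma_1,\gamma_2,k$, decide whether there is $F\subseteq E(G)$ with $|F|\le k$ such that $(V(G),E(G)\setminus F)$ is a $(\gamma_1,\gamma_2)$-cardinality-constrained cluster graph. *)

(* Defs.v *)
From mathcomp Require Import all_boot.
Set Implicit Arguments.
Unset Strict Implicit.
Unset Printing Implicit Defensive.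

Record graph (V : finType) := Graph {
  edges : {set {set V}};
  card_edges : [forall e in edges, #|e| == 2]
}.

Section Graphs.
Variable V : finType.
Implicit Types (G : graph V) (F : {set {set V}}) (A : {set V}).

Definition adj G : rel V := fun u v => [set u; v] \in edges G.

Definition component G (x : V) : {set V} := [set y | connect (adj G) x y].

Definition components G : {set {set V}} := [set component G x | x : V].

Definition clique G A : bool :=
  [forall u in A, forall v in A, (u != v) ==> adj G u v].

Definition cluster_graph G : bool := [forall H in components G, clique G H].

Definition card_constrained (g1 g2 : nat) G : bool :=
  [forall H in components G, g1 <= #|H| <= g2].

Lemma del_edges_subproof G F : [forall e in edges G :\: F, #|e| == 2].
Proof.
apply/'forall_implyP => e; rewrite inE => /andP[_ eG].
by move/'forall_implyP: (card_edges G) => /(_ e eG).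
Qed.

Definition del_edges G F : graph V := Graph (del_edges_subproof G F).

Definition CCClusterDeletion G (g1 g2 k : nat) : bool :=
  [exists F : {set {set V}},
    [&& F \subset edges G, #|F| <= k,
        cluster_graph (del_edges G F)
      & card_constrained g1 g2 (del_edges G F)]].
End Graphs.

(* Random access machine with structured control flow.  There is no
   multiplication; the registers of the machine are the memory cells with
   constant addresses. Subtraction is truncated, so that comparisons are tests
   of differences against 0. *)
Inductive expr : Type :=
| Const of nat
| Deref of expr
| Add of expr & expr
| Sub of expr & expr.

Inductive cmd : Type :=
| Skip
| Store of expr & expr
| Seq of cmd & cmd
| If of expr & cmd & cmd
| While of expr & cmd.

Definition memory := nat -> nat.

Definition update (M : memory) (a v : nat) : memory :=
  fun b => if b == a then v else M b.

Fixpoint eval (M : memory) (e : expr) : nat :=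
  match e with
  | Const m => m
  | Deref a => M (eval M a)
  | Add a b => eval M a + eval M b
  | Sub a b => eval M a - eval M b
  end.

Fixpoint cost (e : expr) : nat :=
  match e with
  | Const _ => 1
  | Deref a => (cost a).+1
  | Add a b | Sub a b => (cost a + cost b).+1
  end.

(* No intermediate value overflows a machine word, the largest word being W. *)
Fixpoint fits (W : nat) (M : memory) (e : expr) : bool :=
  (eval M e <= W) &&
  match e with
  | Const _ => true
  | Deref a => fits W M a
  | Add a b | Sub a b => fits W M a && fits W M b
  end.

(* exec W c M t M': started in memory M, the program c halts in memory M' after
   exactly t steps, without overflow. A program that overflows is stuck, so the
   unit cost of arithmetic is only ever charged on words. *)
Inductive exec (W : nat) : cmd -> memory -> nat -> memory -> Prop :=
| ExecSkip M : exec W Skip M 1 M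
| ExecStore a e M : fits W M a -> fits W M e ->
    exec W (Store a e) M (cost a + cost e).+1 (update M (eval M a) (eval M e))
| ExecSeq c1 c2 M M1 M2 t1 t2 :
    exec W c1 M t1 M1 -> exec W c2 M1 t2 M2 -> exec W (Seq c1 c2) M (t1 + t2) M2
| ExecIfTrue e c1 c2 M M' t : fits W M e -> eval M e != 0 ->
    exec W c1 M t M' -> exec W (If e c1 c2) M (cost e + t).+1 M'
| ExecIfFalse e c1 c2 M M' t : fits W M e -> eval M e = 0 ->
    exec W c2 M t M' -> exec W (If e c1 c2) M (cost e + t).+1 M'
| ExecWhileFalse e c M : fits W M e -> eval M e = 0 ->
    exec W (While e c) M (cost e).+1 M
| ExecWhileTrue e c M M1 M2 t1 t2 : fits W M e -> eval M e != 0 ->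
    exec W c M t1 M1 -> exec W (While e c) M1 t2 M2 ->
    exec W (While e c) M (cost e + t1 + t2).+1 M2.

(* Cells 0 to 3 hold n, g1, g2 and k, the n ^ 2 cells from 4 on hold the
   adjacency matrix row by row, and all other cells hold 0. *)
Definition input (n : nat) (G : graph 'I_n) (g1 g2 k : nat) : memory :=
  fun a => match a with
  | 0 => n
  | 1 => g1
  | 2 => g2
  | 3 => k
  | i.+4 => [exists u : 'I_n, exists v : 'I_n, (i == u * n + v) && adj G u v]
  end.

(* The program leaves its answer in cell 0: 1 for yes, 0 for no. *)
Definition answers (P : cmd) (W T : nat) (M : memory) (b : bool) : Prop :=
  exists (t : nat) (M' : memory),
    [/\ exec W P M t M', t <= T & M' 0 = nat_of_bool b].

(* Main.v *)
Require Import Defs.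
From mathcomp Require Import all_boot.
From mathcomp Require Import zify.

Set Implicit Arguments.
Unset Strict Implicit.
Unset Printing Implicit Defensive.

(** An induced path u-v-w must lose uv or vw, and either choice spends one unit
    of the budget; hence the search tree has at most 2^k leaves, each a disjoint
    union of cliques. At a leaf the remaining cost is a sum over the cliques, and
    the cheapest way to split a clique of size s into parts of sizes in [g1, g2]
    depends on s only and is given by a knapsack recurrence. The leaves are
    enumerated by the numbers x < 2^k, whose binary digits are the successive
    choices.

    Solutions are handled as labellings f of the vertices (the label classes are
    the clusters), and costs count ordered pairs of separated adjacent vertices,
    i.e. twice the number of deleted edges.

    The machine program is compiled from a small language with separate variables
    and arrays and bounded loops only, so that a time bound can be read off the
    syntax; its programs are verified with weakest preconditions. *)

(** * A structured language with variables, arrays and bounded loops *)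

Inductive term : Type :=
| Lit of nat
| Var of nat
| Item of nat & term
| Read of term
| Plus of term & term
| Minus of term & term.

(* The number of iterations of a loop is at most n + 1 or at most 2^k. *)
Variant range : Type := Linear | Exponential.

Inductive prog : Type :=
| Nop
| Assign of nat & term
| Put of nat & term & term
| Then of prog & prog
| Cond of term & prog & prog
| For of range & nat & nat & prog.

Record state := State { vars : nat -> nat; arrays : nat -> nat -> nat }.

Definition set_var (i x : nat) s :=
  State (fun z => if z == i then x else vars s z) (arrays s).

Definition set_item (a j x : nat) s :=
  State (vars s)
    (fun b l => if (b == a) && (l == j) then x else arrays s b l).

Fixpoint writes (c : prog) : seq nat :=
  match c with
  | Nop | Put _ _ _ => [::]
  | Assign i _ => [:: i]
  | Then c1 c2 | Cond _ c1 c2 => writes c1 ++ writes c2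
  | For _ i _ c => i :: writes c
  end.

Fixpoint array_writes (c : prog) : seq nat :=
  match c with
  | Nop | Assign _ _ => [::]
  | Put a _ _ => [:: a]
  | Then c1 c2 | Cond _ c1 c2 => array_writes c1 ++ array_writes c2
  | For _ _ _ c => array_writes c
  end.

Definition unchanged_outside (vs bs : seq nat) (s s' : state) :=
  (forall z, z \notin vs -> vars s' z = vars s z) /\
  (forall b, b \notin bs -> arrays s' b =1 arrays s b).

Lemma unchanged_outside_refl vs bs s : unchanged_outside vs bs s s.
Proof. by []. Qed.

Lemma unchanged_outside_trans vs bs s1 s2 s3 :
  unchanged_outside vs bs s1 s2 -> unchanged_outside vs bs s2 s3 ->
  unchanged_outside vs bs s1 s3.
Proof.
move=> [V1 A1] [V2 A2]; split=> [z nz|b nb j]; first by rewrite V2 ?V1.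
by rewrite A2 ?A1.
Qed.

Lemma unchanged_outside_sub vs bs vs' bs' s s' :
  {subset vs <= vs'} -> {subset bs <= bs'} ->
  unchanged_outside vs bs s s' -> unchanged_outside vs' bs' s s'.
Proof.
move=> sub_vs sub_bs [V A]; split=> [z nz|b nb]; first by rewrite V ?(contra (sub_vs z)).
by apply: A; apply: contra nb; apply: sub_bs.
Qed.

Lemma unchanged_set_var i vs bs x s : unchanged_outside (i :: vs) bs s (set_var i x s).
Proof. by split=> // z; rewrite inE negb_or /= => /andP[/negPf-> _]. Qed.

Lemma unchanged_set_item a j vs bs x s :
  unchanged_outside vs (a :: bs) s (set_item a j x s).
Proof. by split=> // b; rewrite inE negb_or => /andP[/negPf nb _] l /=; rewrite nb. Qed.

Definition unchanged_by (c : prog) := unchanged_outside (writes c) (array_writes c).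

Section Semantics.
Variable inp : memory.

Fixpoint value (s : state) (e : term) : nat :=
  match e with
  | Lit m => m
  | Var i => vars s i
  | Item a e => arrays s a (value s e)
  | Read e => inp (value s e)
  | Plus e1 e2 => value s e1 + value s e2
  | Minus e1 e2 => value s e1 - value s e2
  end.

Definition iteration (body : state -> state) i j (s : state) := body (set_var i j s).

Fixpoint run (c : prog) (s : state) : state :=
  match c with
  | Nop => s
  | Assign i e => set_var i (value s e) s
  | Put a e1 e2 => set_item a (value s e1) (value s e2) s
  | Then c1 c2 => run c2 (run c1 s)
  | Cond e c1 c2 => if value s e == 0 then run c2 s else run c1 s
  | For _ i x c => set_var i (vars s x) (iteri (vars s x) (iteration (run c) i) s)
  end.

Lemma unchanged_iteri (c : prog) i m s :
  (forall s, unchanged_by c s (run c s)) ->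
  unchanged_outside (i :: writes c) (array_writes c) s
    (iteri m (iteration (run c) i) s).
Proof.
move=> frame_c; elim: m => [|m IH] /=; first exact: unchanged_outside_refl.
apply: unchanged_outside_trans IH _; apply: unchanged_outside_trans (unchanged_set_var _ _ _ _ _) _.
by apply: unchanged_outside_sub (frame_c _) => // z zc; rewrite inE zc orbT.
Qed.

Lemma run_unchanged c s : unchanged_by c s (run c s).
Proof.
elim: c s => [|i e|a e1 e2|c1 IH1 c2 IH2|e c1 IH1 c2 IH2|r i x c IH] s.
- exact: unchanged_outside_refl.
- exact: unchanged_set_var.
- exact: unchanged_set_item.
- apply: unchanged_outside_trans (unchanged_outside_sub _ _ (IH1 s))
    (unchanged_outside_sub _ _ (IH2 _)) => z; by rewrite mem_cat => ->; rewrite ?orbT.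
- rewrite /=; case: ifP => _; [move: (IH2 s)|move: (IH1 s)];
    by apply: unchanged_outside_sub => z; rewrite mem_cat => ->; rewrite ?orbT.
exact: unchanged_outside_trans (unchanged_iteri i (vars s x) s IH) (unchanged_set_var _ _ _ _ _).
Qed.

Variables (n max_value : nat) (max_iter : range -> nat) (readable : nat -> Prop).

Definition capacity := (n * n + n).+1.

(* The addresses of array items are computed from variable 0. *)
Definition addressable (s : state) j := j < capacity /\ vars s 0 = n * n.

Fixpoint defined (s : state) (e : term) : Prop :=
  match e with
  | Lit _ | Var _ => True
  | Item _ e => defined s e /\ addressable s (value s e)
  | Read e => defined s e /\ readable (value s e)
  | Plus e1 e2 | Minus e1 e2 => defined s e1 /\ defined s e2
  end.

Fixpoint safe (c : prog) (s : state) : Prop :=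
  match c with
  | Nop => True
  | Assign _ e => defined s e /\ value s e <= max_value
  | Put _ e1 e2 =>
      [/\ defined s e1, addressable s (value s e1), defined s e2 & value s e2 <= max_value]
  | Then c1 c2 => safe c1 s /\ safe c2 (run c1 s)
  | Cond e c1 c2 => defined s e /\ (if value s e == 0 then safe c2 s else safe c1 s)
  | For r i x c =>
      vars s x <= max_iter r /\
      forall j, j < vars s x -> safe c (set_var i j (iteri j (iteration (run c) i) s))
  end.

Definition denotes (s : state) (e : term) x := defined s e /\ value s e = x.

Definition wp (c : prog) (Q : state -> Prop) (s : state) := safe c s /\ Q (run c s).

Lemma denotes_var s i x : vars s i = x -> denotes s (Var i) x.
Proof. by []. Qed.

Lemma denotes_plus s e1 e2 x1 x2 :
  denotes s e1 x1 -> denotes s e2 x2 -> denotes s (Plus e1 e2) (x1 + x2).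
Proof. by move=> [def1 <-] [def2 <-]. Qed.

Lemma denotes_minus s e1 e2 x1 x2 :
  denotes s e1 x1 -> denotes s e2 x2 -> denotes s (Minus e1 e2) (x1 - x2).
Proof. by move=> [def1 <-] [def2 <-]. Qed.

Lemma wp_consequence c (Q Q' : state -> Prop) s :
  wp c Q s ->
  (forall s', Q s' -> unchanged_by c s s' -> Q' s') ->
  wp c Q' s.
Proof. by case=> ok q QQ'; split=> //; apply: QQ' => //; apply: run_unchanged. Qed.

Lemma wp_nop Q s : Q s -> wp Nop Q s.
Proof. by []. Qed.

Lemma wp_assign i e x Q s :
  denotes s e x -> x <= max_value -> Q (set_var i x s) -> wp (Assign i e) Q s.
Proof. by case=> def <- le q; split. Qed.

Lemma wp_put a e1 e2 j x Q s :
  denotes s e1 j -> addressable s j -> denotes s e2 x -> x <= max_value ->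
  Q (set_item a j x s) -> wp (Put a e1 e2) Q s.
Proof. by case=> def1 <- adr [def2 <-] le q; split. Qed.

Lemma wp_seq c1 c2 Q s : wp c1 (wp c2 Q) s -> wp (Then c1 c2) Q s.
Proof. by case=> ok1 [ok2 q]; split. Qed.

Lemma wp_then c1 c2 (Q1 Q : state -> Prop) s :
  wp c1 Q1 s ->
  (forall s', Q1 s' -> unchanged_by c1 s s' -> wp c2 Q s') ->
  wp (Then c1 c2) Q s.
Proof. by move=> wp1 wp2; apply: wp_seq; apply: wp_consequence wp1 wp2. Qed.

Lemma wp_cond e x c1 c2 Q s :
  denotes s e x -> (if x == 0 then wp c2 Q s else wp c1 Q s) -> wp (Cond e c1 c2) Q s.
Proof.
by case=> def <-; rewrite /wp /=; case: ifP => _ [ok q]; split.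
Qed.

Lemma wp_for m r i x c (Inv : nat -> state -> Prop) (Q : state -> Prop) s :
  vars s x = m -> m <= max_iter r -> Inv 0 s ->
  (forall j s', j < m -> Inv j s' ->
    unchanged_by (For r i x c) s (set_var i j s') ->
    wp c (Inv j.+1) (set_var i j s')) ->
  (forall s', Inv m s' ->
    unchanged_by (For r i x c) s (set_var i m s') ->
    Q (set_var i m s')) ->
  wp (For r i x c) Q s.
Proof.
move=> xm le_m Inv0 InvS Q_end; pose after j := iteri j (iteration (run c) i) s.
have unchanged j : unchanged_by (For r i x c) s (set_var i j (after j)).
  apply: unchanged_outside_trans (unchanged_set_var _ _ _ _ _).
  by apply: unchanged_iteri => s'; apply: run_unchanged.
have inv j : j <= m -> Inv j (after j).
  by elim: j => // j IH lt; have [] := InvS j (after j) lt (IH (ltnW lt)) (unchanged j).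
rewrite /wp /= xm; split; last exact: Q_end (inv m (leqnn m)) (unchanged m).
by split=> // j lt; have [] := InvS j (after j) lt (inv j (ltnW lt)) (unchanged j).
Qed.
End Semantics.

Arguments denotes_var {inp n readable s i x}.
Arguments wp_assign {inp n max_value max_iter readable i e x Q s}.
Arguments wp_put {inp n max_value max_iter readable a e1 e2 j x Q s}.

(** * Compilation to the random access machine *)

Section Compiler.
Variables nvars narrays : nat.

Definition mul_expr m e := iter m (Add e) (Const 0).
Definition size_expr := Deref (Const 0).
(* Variable i lives in cell 4 + i(n+1). This is a diagonal entry of the adjacency
   matrix or a cell beyond the matrix, so it holds 0 in the input and carries no
   information; unlike the cells beyond the matrix in general, it is addressable
   without knowing n^2. *)
Definition var_expr i := Add (Const (4 + i)) (mul_expr i size_expr).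
Definition capacity_expr := Add (Deref (var_expr 0)) (Add size_expr (Const 1)).
Definition item_expr a e :=
  Add (Add (Const (4 + nvars)) (mul_expr nvars size_expr))
      (Add (mul_expr a.+1 capacity_expr) e).

Fixpoint compile_term (e : term) : expr :=
  match e with
  | Lit m => Const m
  | Var i => Deref (var_expr i)
  | Item a e => Deref (item_expr a (compile_term e))
  | Read e => Deref (compile_term e)
  | Plus e1 e2 => Add (compile_term e1) (compile_term e2)
  | Minus e1 e2 => Defs.Sub (compile_term e1) (compile_term e2)
  end.

Definition loop_test i x := Defs.Sub (Deref (var_expr x)) (Deref (var_expr i)).
Definition successor_expr i := Add (Deref (var_expr i)) (Const 1).
Definition increment i := Store (var_expr i) (successor_expr i).

Fixpoint compile (c : prog) : cmd :=
  match c with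
  | Nop => Skip
  | Assign i e => Store (var_expr i) (compile_term e)
  | Put a e1 e2 => Store (item_expr a (compile_term e1)) (compile_term e2)
  | Then c1 c2 => Seq (compile c1) (compile c2)
  | Cond e c1 c2 => If (compile_term e) (compile c1) (compile c2)
  | For _ i x c =>
      Seq (Store (var_expr i) (Const 0))
          (While (loop_test i x) (Seq (compile c) (increment i)))
  end.

Fixpoint wf_term (e : term) : bool :=
  match e with
  | Lit m => true
  | Var i => i < nvars
  | Item a e => (a < narrays) && wf_term e
  | Read e => wf_term e
  | Plus e1 e2 | Minus e1 e2 => wf_term e1 && wf_term e2
  end.

Fixpoint wf_prog (c : prog) : bool :=
  match c with
  | Nop => true
  | Assign i e => (i < nvars) && wf_term e
  | Put a e1 e2 => [&& a < narrays, wf_term e1 & wf_term e2]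
  | Then c1 c2 => wf_prog c1 && wf_prog c2
  | Cond e c1 c2 => [&& wf_term e, wf_prog c1 & wf_prog c2]
  | For _ i x c =>
      [&& i < nvars, x < nvars, x \notin i :: writes c, i \notin writes c & wf_prog c]
  end.

Fixpoint weight (e : term) : nat :=
  match e with
  | Lit m => m.+1
  | Var _ => 1
  | Item _ e | Read e => (weight e).+1
  | Plus e1 e2 | Minus e1 e2 => weight e1 + weight e2
  end.

Fixpoint prog_weight (c : prog) : nat :=
  match c with
  | Nop => 0
  | Assign _ e => weight e
  | Put _ e1 e2 => maxn (weight e1) (weight e2)
  | Then c1 c2 => maxn (prog_weight c1) (prog_weight c2)
  | Cond e c1 c2 => maxn (weight e) (maxn (prog_weight c1) (prog_weight c2))
  | For _ _ _ c => prog_weight c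
  end.

Definition loop_cost i x := cost (var_expr i) + cost (loop_test i x) + 3.
Definition iteration_cost i x :=
  cost (loop_test i x) + cost (var_expr i) + cost (successor_expr i) + 2.

Section Time.
Variable max_iter : range -> nat.

Fixpoint time_bound (c : prog) : nat :=
  match c with
  | Nop => 1
  | Assign i e => (cost (var_expr i) + cost (compile_term e)).+1
  | Put a e1 e2 =>
      (cost (item_expr a (compile_term e1)) + cost (compile_term e2)).+1
  | Then c1 c2 => time_bound c1 + time_bound c2
  | Cond e c1 c2 => (cost (compile_term e) + (time_bound c1 + time_bound c2)).+1
  | For r i x c => loop_cost i x + max_iter r * (iteration_cost i x + time_bound c)
  end.
End Time.

Definition is_linear (r : range) : bool := if r is Linear then true else false.

Fixpoint depth (p : pred range) (c : prog) : nat :=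
  match c with
  | Then c1 c2 | Cond _ c1 c2 => maxn (depth p c1) (depth p c2)
  | For r _ _ c => p r + depth p c
  | _ => 0
  end.

Lemma time_bound_poly max_iter c : (forall r, 0 < max_iter r) ->
  time_bound max_iter c <= time_bound (fun=> 1) c *
    (max_iter Linear ^ depth is_linear c * max_iter Exponential ^ depth (predC is_linear) c).
Proof.
move=> iter_gt0; pose iters c :=
  max_iter Linear ^ depth is_linear c * max_iter Exponential ^ depth (predC is_linear) c.
have iters_gt0 c' : 0 < iters c' by rewrite muln_gt0 !expn_gt0 !iter_gt0.
have le_iters_then c1 c2 : iters c1 <= iters (Then c1 c2) /\ iters c2 <= iters (Then c1 c2).
  by split; apply: leq_mul; rewrite leq_pexp2l ?leq_maxl ?leq_maxr.
rewrite -/(iters c); elim: c => [|i e|a e1 e2|c1 IH1 c2 IH2|e c1 IH1 c2 IH2|r i x c IH].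
- by rewrite leq_pmulr.
- by rewrite leq_pmulr.
- by rewrite leq_pmulr.
- have [le1 le2] := le_iters_then c1 c2; rewrite /= mulnDl leq_add //.
    exact: leq_trans IH1 (leq_mul _ le1).
  exact: leq_trans IH2 (leq_mul _ le2).
- have [le1 le2] := le_iters_then c1 c2.
  rewrite /= -!addSn !mulnDl leq_add ?leq_pmulr // leq_add //.
    exact: leq_trans IH1 (leq_mul _ le1).
  exact: leq_trans IH2 (leq_mul _ le2).
have iters_for : iters (For r i x c) = max_iter r * iters c.
  by rewrite /iters; case: r; rewrite /= ?add0n ?add1n expnS; lia.
rewrite /= mul1n mulnDl leq_add ?leq_pmulr // iters_for mulnCA leq_mul //.
by rewrite mulnDl leq_add ?leq_pmulr.
Qed.
End Compiler.

Section Words.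
Variable W : nat.
Implicit Type M : memory.

Definition evaluates M e x := fits W M e /\ eval M e = x.

Lemma evaluates_le M e x : evaluates M e x -> x <= W.
Proof. by case=> + <-; case: e => [?|?|? ?|? ?] /= /andP[]. Qed.

Lemma evaluates_const M m : m <= W -> evaluates M (Const m) m.
Proof. by move=> le; split=> //=; rewrite le. Qed.

Lemma evaluates_deref M e x : evaluates M e x -> M x <= W -> evaluates M (Deref e) (M x).
Proof. by case=> f <- le; split=> //=; rewrite f le. Qed.

Lemma evaluates_add M e1 e2 x1 x2 :
  evaluates M e1 x1 -> evaluates M e2 x2 -> x1 + x2 <= W ->
  evaluates M (Add e1 e2) (x1 + x2).
Proof. by case=> f1 <- [f2 <-] le; split=> //=; rewrite f1 f2 le. Qed.

Lemma evaluates_sub M e1 e2 x1 x2 :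
  evaluates M e1 x1 -> evaluates M e2 x2 -> evaluates M (Defs.Sub e1 e2) (x1 - x2).
Proof.
move=> y1; have := evaluates_le y1; case: y1 => f1 <- le1 [f2 <-].
by split=> //=; rewrite f1 f2 !andbT (leq_trans (leq_subr _ _)).
Qed.

Lemma evaluates_mul M m e x :
  evaluates M e x -> m * x <= W -> evaluates M (mul_expr m e) (m * x).
Proof.
move=> ye; elim: m => [|m IH] le; first exact: evaluates_const.
rewrite mulSn; apply: evaluates_add => //; apply: IH.
by apply: leq_trans le; rewrite leq_mul2r leqnSn orbT.
Qed.

Lemma exec_store M a e x y : evaluates M a x -> evaluates M e y ->
  exec W (Store a e) M (cost a + cost e).+1 (update M x y).
Proof. by case=> fa <- [fe <-]; apply: ExecStore. Qed.
End Words.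

Section Soundness.
Variables (nvars narrays n max_value W : nat) (max_iter : range -> nat) (inp : memory).

Definition var_addr i := 4 + i * n.+1.

(* The first array begins beyond the variables and the adjacency matrix. *)
Definition item_addr a j := 4 + nvars * n.+1 + a.+1 * capacity n + j.

Definition readable a := a < 4 + n * n /\ forall i, i < nvars -> a <> var_addr i.

Lemma readable_param a : a < 4 -> readable a.
Proof. by move=> lt; split=> [|i _]; rewrite /var_addr; lia. Qed.

Lemma var_addr_inj : injective var_addr.
Proof. by move=> i j /addnI/eqP; rewrite eqn_pmul2r // => /eqP. Qed.

Lemma var_addr_lt_item i a j : i < nvars -> var_addr i < item_addr a j.
Proof.
move=> lti; rewrite /item_addr -!addnA ltn_add2l; apply: leq_trans (leq_addr _ _).
by rewrite ltn_pmul2r.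
Qed.

Lemma readable_lt_item a b j : readable a -> a < item_addr b j.
Proof. by case=> lt _; rewrite /item_addr mulSn {1}/capacity; lia. Qed.

Lemma item_addr_lt a b i : a < b -> i < capacity n -> item_addr a i < item_addr b 0.
Proof. by move=> lt lti; have := leq_mul lt (leqnn (capacity n)); rewrite /item_addr; lia. Qed.

Lemma item_addr_inj a b i j : i < capacity n -> j < capacity n ->
  item_addr a i = item_addr b j -> a = b /\ i = j.
Proof.
move=> lti ltj E; case: (ltngtP a b) => [lt|lt|ab].
- by have := item_addr_lt lt lti; rewrite E /item_addr; lia.
- by have := item_addr_lt lt ltj; rewrite -E /item_addr; lia.
- by move: E; rewrite ab => /addnI.
Qed.

Record represents (s : state) (M : memory) : Prop := Represents {
  represents_input : forall a, readable a -> M a = inp a;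
  represents_var : forall i, i < nvars -> M (var_addr i) = vars s i;
  represents_item : forall a j, a < narrays -> j < capacity n ->
    M (item_addr a j) = arrays s a j;
  var_le : forall i, i < nvars -> vars s i <= max_value;
  item_le : forall a j, a < narrays -> j < capacity n -> arrays s a j <= max_value
}.

Lemma represents_set_var s M i x : represents s M -> i < nvars -> x <= max_value ->
  represents (set_var i x s) (update M (var_addr i) x).
Proof.
case=> Min Mvar Mitem Bvar Bitem lti lex; split; rewrite /update /=.
- move=> a oka; case: eqP => [E|_]; last exact: Min.
  by case: oka => _ /(_ i lti).
- by move=> j ltj; rewrite (inj_eq var_addr_inj); case: ifP => // _; apply: Mvar.
- move=> a j lta ltj; case: eqP => [E|_]; last exact: Mitem.
  by have := var_addr_lt_item a j lti; rewrite E ltnn.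
- by move=> j ltj; case: eqP => // _; apply: Bvar.
- exact: Bitem.
Qed.

Lemma represents_set_item s M a j x :
  represents s M -> a < narrays -> j < capacity n -> x <= max_value ->
  represents (set_item a j x s) (update M (item_addr a j) x).
Proof.
case=> Min Mvar Mitem Bvar Bitem lta ltj lex; split; rewrite /update /=.
- move=> b okb; case: eqP => [E|_]; last exact: Min.
  by have := readable_lt_item a j okb; rewrite E ltnn.
- move=> i lti; case: eqP => [E|_]; last exact: Mvar.
  by have := var_addr_lt_item a j lti; rewrite E ltnn.
- move=> b i ltb lti; case: eqP => [/item_addr_inj[] // -> ->|ne]; first by rewrite !eqxx.
  by case: andP => [[/eqP E1 /eqP E2]|_]; [rewrite E1 E2 in ne | apply: Mitem].
- exact: Bvar.
- by move=> b i ltb lti; case: andP => // _; apply: Bitem.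
Qed.

Hypothesis nvars_gt0 : 0 < nvars.
Hypothesis inp_size : inp 0 = n.
Hypothesis inp_le : forall a, readable a -> inp a <= max_value.
Hypothesis value_fits : max_value < W.
Hypothesis addr_fits : item_addr narrays 0 <= W.

Lemma var_addr_fits i : i < nvars -> var_addr i <= W.
Proof. by move=> lti; apply: leq_trans addr_fits; apply: ltnW; apply: var_addr_lt_item. Qed.

Lemma evaluates_size s M : represents s M -> evaluates W M size_expr n.
Proof.
move=> rep; have M0 : M 0 = n by rewrite (represents_input rep) //; apply: readable_param.
rewrite -[X in evaluates _ _ _ X]M0; apply: evaluates_deref; first exact: evaluates_const.
by rewrite M0; apply: leq_trans addr_fits; rewrite /item_addr /capacity; lia.
Qed.

Lemma evaluates_var_addr s M i :
  represents s M -> i < nvars -> evaluates W M (var_expr i) (var_addr i).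
Proof.
move=> rep lti; have := var_addr_fits lti; rewrite /var_addr mulnS addnA => le.
apply: evaluates_add (le); [apply: evaluates_const | apply: evaluates_mul (evaluates_size rep) _].
  exact: leq_trans (leq_addr _ _) le.
exact: leq_trans (leq_addl _ _) le.
Qed.

Lemma evaluates_var s M i :
  represents s M -> i < nvars -> evaluates W M (Deref (var_expr i)) (vars s i).
Proof.
move=> rep lti; rewrite -(represents_var rep lti).
apply: evaluates_deref (evaluates_var_addr rep lti) _.
by rewrite (represents_var rep lti) (leq_trans (var_le rep lti)) // ltnW.
Qed.

Lemma evaluates_item_addr s M a e j : represents s M -> a < narrays -> addressable n s j ->
  evaluates W M e j -> evaluates W M (item_expr nvars a e) (item_addr a j).
Proof.
move=> rep lta [ltj v0] ej; have en := evaluates_size rep.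
have := leq_trans (ltnW (item_addr_lt lta ltj)) addr_fits.
have -> : item_addr a j = 4 + nvars + nvars * n + (a.+1 * capacity n + j).
  by rewrite /item_addr mulnS; lia.
have : capacity n <= a.+1 * capacity n by rewrite leq_pmull.
rewrite {1}/capacity => le_cap le.
have le_base : 4 + nvars + nvars * n <= W := leq_trans (leq_addr _ _) le.
have le_offset : a.+1 * capacity n + j <= W := leq_trans (leq_addl _ _) le.
have e0 : evaluates W M (Deref (var_expr 0)) (n * n) by rewrite -v0; apply: evaluates_var.
have ecap : evaluates W M capacity_expr (capacity n).
  rewrite /capacity -addnS -addn1.
  by apply: evaluates_add e0 (evaluates_add en _ _) _; try apply: evaluates_const; lia.
apply: evaluates_add le.
  apply: evaluates_add (le_base); [apply: evaluates_const | apply: evaluates_mul en _].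
    exact: leq_trans (leq_addr _ _) le_base.
  exact: leq_trans (leq_addl _ _) le_base.
apply: evaluates_add ej (le_offset); apply: evaluates_mul ecap _.
exact: leq_trans (leq_addr _ _) le_offset.
Qed.

Local Notation defined := (defined inp n readable).
Local Notation safe := (safe inp n max_value max_iter readable).
Local Notation run := (run inp).
Local Notation value := (value inp).

Lemma value_le_weight s M e : represents s M -> wf_term nvars narrays e -> defined s e ->
  value s e <= weight e * max_value.+1.
Proof.
move=> rep; elim: e => [m|i|a e IH|e IH|e1 IH1 e2 IH2|e1 IH1 e2 IH2] /=.
- by move=> _ _; rewrite mulSn mulnS; lia.
- by move=> lti _; rewrite mul1n leqW // (var_le rep).
- by case/andP=> lta _ [_ [lt _]]; rewrite mulSn; have := item_le rep lta lt; lia.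
- by move=> _ [_ /inp_le]; rewrite mulSn; lia.
- by case/andP=> /IH1 le1 /IH2 le2 [/le1 ? /le2 ?]; rewrite mulnDl leq_add.
- by case/andP=> /IH1 le1 /IH2 le2 [/le1 ? /le2 ?]; rewrite mulnDl; lia.
Qed.

Lemma evaluates_compile_term s M e :
  represents s M -> wf_term nvars narrays e -> weight e * max_value.+1 <= W -> defined s e ->
  evaluates W M (compile_term nvars e) (value s e).
Proof.
have word x : x <= max_value -> x <= W by move/leq_trans; apply; apply: ltnW.
move=> rep; elim: e => [m|i|a e IH|e IH|e1 IH1 e2 IH2|e1 IH1 e2 IH2] /=.
- by move=> _ le _; apply: evaluates_const; move: le; rewrite mulSn mulnS; lia.
- by move=> lti _ _; apply: evaluates_var.
- case/andP=> lta wf le [def adr]; rewrite -(represents_item rep lta adr.1).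
  apply: evaluates_deref; first by apply: (evaluates_item_addr rep) => //; apply: IH => //; lia.
  by rewrite (represents_item rep) ?word ?(item_le rep) ?adr.1.
- move=> wf le [def rd]; rewrite -(represents_input rep rd).
  apply: evaluates_deref; first by apply: IH => //; lia.
  by rewrite (represents_input rep) ?word ?inp_le.
- case/andP=> wf1 wf2 le [def1 def2]; apply: evaluates_add.
  + by apply: IH1 => //; lia.
  + by apply: IH2 => //; lia.
  by apply: leq_trans le; rewrite mulnDl leq_add // (value_le_weight rep).
case/andP=> wf1 wf2 le [def1 def2]; apply: evaluates_sub.
- by apply: IH1 => //; lia.
- by apply: IH2 => //; lia.
Qed.

Lemma evaluates_loop_test s M i x : represents s M -> i < nvars -> x < nvars ->
  evaluates W M (loop_test i x) (vars s x - vars s i).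
Proof. by move=> rep lti ltx; apply: evaluates_sub; apply: (evaluates_var rep). Qed.

Lemma exec_increment s M i : represents s M -> i < nvars -> vars s i < max_value ->
  exists M', exec W (increment i) M (cost (var_expr i) + cost (successor_expr i)).+1 M' /\
    represents (set_var i (vars s i).+1 s) M'.
Proof.
move=> rep lti lt; exists (update M (var_addr i) (vars s i).+1); split; last first.
  exact: represents_set_var.
apply: exec_store (evaluates_var_addr rep lti) _; rewrite -[(vars s i).+1]addn1.
by apply: evaluates_add (evaluates_var rep lti) _ _; [apply: evaluates_const|]; lia.
Qed.

Local Notation compile := (compile nvars).
Local Notation wf_prog := (wf_prog nvars narrays).
Local Notation time_bound := (time_bound nvars max_iter).

Definition simulates c t (s s' : state) := forall M, represents s M ->
  exists t' M', [/\ exec W c M t' M', t' <= t & represents s' M'].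

Section Loop.
Variables (r : range) (i x : nat) (c : prog) (s : state).
Hypothesis wf : wf_prog (For r i x c).
Local Notation after j := (iteri j (iteration (run c) i) s).
Hypothesis sim_body : forall j, j < vars s x ->
  simulates (compile c) (time_bound c) (set_var i j (after j)) (after j.+1).

Lemma vars_after_bound j : vars (after j) x = vars s x.
Proof.
have [_ _ nx _ _] := and5P wf.
by have [-> //] := unchanged_iteri i j s (run_unchanged inp c).
Qed.

Lemma vars_after_counter j : vars (after j.+1) i = j.
Proof.
have [_ _ _ ni _] := and5P wf.
by have [-> //] := run_unchanged inp c (set_var i j (after j)); rewrite /= eqxx.
Qed.

Lemma simulates_while m j : j + m = vars s x ->
  simulates (While (loop_test i x) (Seq (compile c) (increment i)))
    ((cost (loop_test i x)).+1 + m * (iteration_cost i x + time_bound c))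
    (set_var i j (after j)) (set_var i (vars s x) (after (vars s x))).
Proof.
have [lti ltx + _ _] := and5P wf; rewrite inE negb_or => /andP[/negPf nxi _].
have bound l : vars (set_var i l (after l)) x = vars s x by rewrite /= nxi vars_after_bound.
elim: m j => [|m IH] j jm M rep; have := evaluates_loop_test rep lti ltx;
  rewrite bound [vars _ i]/= eqxx => -[fit_test eval_test].
  rewrite addn0 in jm; exists (cost (loop_test i x)).+1, M; rewrite mul0n addn0 -jm.
  by split=> //; apply: ExecWhileFalse => //; rewrite eval_test jm subnn.
have ltj : j < vars s x by rewrite -jm -addSnnS leq_addr.
have [t1 [M1 [exec1 le1 rep1]]] := sim_body ltj rep.
have lt_max : j < max_value by apply: leq_trans ltj _; rewrite -(bound j) (var_le rep).
have [] := @exec_increment _ _ i rep1 lti; first by rewrite vars_after_counter.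
rewrite vars_after_counter => M2 [exec2 rep2].
have [t3 [M3 [exec3 le3 rep3]]] := IH j.+1 (etrans (addSnnS j m) jm) _ rep2.
exists (cost (loop_test i x) +
  (t1 + (cost (var_expr i) + cost (successor_expr i)).+1) + t3).+1, M3; split=> //.
  apply: ExecWhileTrue (ExecSeq exec1 exec2) exec3 => //.
  by rewrite eval_test -lt0n subn_gt0.
by rewrite mulSn {1}/iteration_cost; lia.
Qed.

Lemma simulates_for : vars s x <= max_iter r ->
  simulates (compile (For r i x c)) (time_bound (For r i x c)) s (run (For r i x c) s).
Proof.
move=> le_iter M rep; have [lti _ _ _ _] := and5P wf.
have rep0 := represents_set_var rep lti (leq0n max_value).
have [t [M' [exec' le rep']]] := simulates_while (add0n (vars s x)) rep0.
exists ((cost (var_expr i) + 1).+1 + t), M'; split=> //.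
  apply: ExecSeq exec'.
  exact: exec_store (evaluates_var_addr rep lti) (evaluates_const _ (leq0n W)).
move: (leq_mul le_iter (leqnn (iteration_cost i x + time_bound c))).
by rewrite [time_bound (For _ _ _ _)]/= /loop_cost; lia.
Qed.
End Loop.

Lemma compile_sound c s : wf_prog c -> prog_weight c * max_value.+1 <= W -> safe c s ->
  simulates (compile c) (time_bound c) s (run c s).
Proof.
have weight_max p q : maxn p q * max_value.+1 <= W ->
    p * max_value.+1 <= W /\ q * max_value.+1 <= W.
  by move=> le; split; apply: leq_trans le; rewrite leq_mul2r ?leq_maxl ?leq_maxr orbT.
elim: c s => [|i e|a e1 e2|c1 IH1 c2 IH2|e c1 IH1 c2 IH2|r i x c IH] s.
- by move=> _ _ _ M rep; exists 1, M; split=> //; apply: ExecSkip.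
- case/andP=> lti wf le [def lev] M rep; eexists; eexists; split.
  + exact: exec_store (evaluates_var_addr rep lti) (evaluates_compile_term rep wf le def).
  + exact: leqnn.
  + exact: represents_set_var.
- case/and3P=> lta wf1 wf2 /weight_max[le1 le2] [def1 adr def2 lev] M rep.
  eexists; eexists; split.
  + apply: exec_store (evaluates_compile_term rep wf2 le2 def2).
    exact: evaluates_item_addr rep lta adr (evaluates_compile_term rep wf1 le1 def1).
  + exact: leqnn.
  + exact: represents_set_item rep lta adr.1 lev.
- case/andP=> wf1 wf2 /weight_max[le1 le2] [safe1 safe2] M rep.
  have [t1 [M1 [exec1 t1_le rep1]]] := IH1 s wf1 le1 safe1 M rep.
  have [t2 [M2 [exec2 t2_le rep2]]] := IH2 _ wf2 le2 safe2 M1 rep1.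
  by exists (t1 + t2), M2; split=> //; [apply: ExecSeq exec1 exec2 | apply: leq_add].
- case/and3P=> wf wf1 wf2 /weight_max[le /weight_max[le1 le2]] [def +] M rep.
  have [fit_e eval_e] := evaluates_compile_term rep wf le def.
  rewrite /=; case: eqP => [e0|/eqP e0] safe_branch.
    have [t [M' [exec' t_le rep']]] := IH2 s wf2 le2 safe_branch M rep.
    exists (cost (compile_term nvars e) + t).+1, M'; split=> //; last by lia.
    by apply: ExecIfFalse; rewrite ?eval_e.
  have [t [M' [exec' t_le rep']]] := IH1 s wf1 le1 safe_branch M rep.
  exists (cost (compile_term nvars e) + t).+1, M'; split=> //; last by lia.
  by apply: ExecIfTrue; rewrite ?eval_e.
move=> wf le [le_iter safe_body]; apply: simulates_for => // j ltj.
by apply: IH => //; [case/and5P: wf | apply: safe_body].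
Qed.
End Soundness.

(** * Cluster deletion as labelling *)

Lemma set2_eq (T : finType) (a b u v : T) :
  ([set a; b] == [set u; v]) = (a == u) && (b == v) || (a == v) && (b == u).
Proof.
apply/eqP/orP => [E|[]/andP[/eqP-> /eqP->]//]; last by rewrite setUC.
have /set2P Ea : a \in [set u; v] by rewrite -E set21.
have /set2P Eb : b \in [set u; v] by rewrite -E set22.
have /set2P Eu : u \in [set a; b] by rewrite E set21.
have /set2P Ev : v \in [set a; b] by rewrite E set22.
by case: Ea Eb Eu Ev => -> [] -> [] eu [] ev; rewrite ?eqxx -?eu -?ev ?eqxx; auto.
Qed.

Lemma sum_bool_le (T : finType) (P : pred T) : \sum_x P x <= #|T|.
Proof. by rewrite -[leqRHS]sum1_card; apply: leq_sum => x _; apply: leq_b1. Qed.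

Section Graphs.
Variable V : finType.
Implicit Types (G H : graph V) (F : {set {set V}}) (f : V -> V) (S B : {set V}).

Lemma adj_sym G : symmetric (adj G).
Proof. by move=> u v; rewrite /adj setUC. Qed.

Lemma card_edge G e : e \in edges G -> #|e| = 2.
Proof. by move=> eG; apply/eqP; move/'forall_implyP: (card_edges G); apply. Qed.

Lemma adj_irrefl G : irreflexive (adj G).
Proof. by move=> u; apply/negP=> /card_edge; rewrite setUid cards1. Qed.

Lemma adj_del_edges G F u v : adj (del_edges G F) u v = adj G u v && ([set u; v] \notin F).
Proof. by rewrite /adj inE andbC. Qed.

Lemma connect_adj_sym G : connect_sym (adj G).
Proof. exact/sym_connect_sym/adj_sym. Qed.

Lemma mem_component G u : u \in component G u.
Proof. by rewrite inE connect0. Qed.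

Lemma component_in G u : component G u \in components G.
Proof. exact: imset_f. Qed.

Lemma component_eq G u v : (component G u == component G v) = (u \in component G v).
Proof.
apply/eqP/idP => [<-|]; first exact: mem_component.
rewrite inE => vu; apply/setP=> w; rewrite !inE.
exact/esym/(same_connect (connect_adj_sym G)).
Qed.

Lemma component_of_mem G S u : S \in components G -> (component G u == S) = (u \in S).
Proof. by case/imsetP=> v _ ->; rewrite component_eq. Qed.

Lemma cluster_component G u : cluster_graph G ->
  component G u = [set v | (v == u) || adj G u v].
Proof.
move=> cluster; apply/setP=> v; apply/idP/idP; rewrite !inE.
  move/'forall_implyP: cluster => /(_ _ (component_in G u)) /'forall_implyP.
  move=> /(_ u (mem_component G u)) /'forall_implyP cl uv.
  by have := cl v; rewrite inE eq_sym => /(_ uv); case: eqP.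
by case/orP=> [/eqP-> //|]; apply: connect1.
Qed.

Lemma card_cluster_component G u : cluster_graph G ->
  #|component G u| = 1 + \sum_v adj G u v.
Proof.
move=> cluster; have -> : component G u = u |: [set v | adj G u v].
  by rewrite cluster_component //; apply/setP=> v; rewrite !inE.
by rewrite cardsU1 inE adj_irrefl -sum1dep_card big_mkcond.
Qed.

Definition induced_P3 G u v w := [&& adj G u v, adj G v w, u != w & ~~ adj G u w].

Lemma P3_free_cluster G : (forall u v w, ~~ induced_P3 G u v w) -> cluster_graph G.
Proof.
move=> P3_free; have ends_adj p u : path (adj G) u p -> u != last u p -> adj G u (last u p).
  elim/last_ind: p => [|p w IH] /=; first by rewrite eqxx.
  rewrite rcons_path last_rcons => /andP[up pw] uw.
  have [-> // |ne] := eqVneq u (last u p).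
  by have := P3_free u (last u p) w; rewrite /induced_P3 (IH up ne) pw uw /= negbK.
apply/'forall_implyP=> _ /imsetP[x _ ->]; apply/'forall_implyP=> u; rewrite inE => xu.
apply/'forall_implyP=> v; rewrite inE => xv; apply/implyP=> uv.
have /connectP[p up vp] : connect (adj G) u v.
  by apply: connect_trans xv; rewrite (connect_adj_sym G).
by rewrite vp ends_adj // -vp.
Qed.

Lemma handshake F : {in F, forall e : {set V}, #|e| = 2} ->
  \sum_u #|[set v | [set u; v] \in F]| = 2 * #|F|.
Proof.
move=> F2; have degree u : #|[set v | [set u; v] \in F]| = \sum_(e in F) (u \in e).
  transitivity #|[set e in F | u \in e]|; last first.
    by rewrite -sum1dep_card big_mkcondr; apply: eq_bigr => e _; case: (u \in e).
  rewrite -(@card_in_imset _ _ (fun v => [set u; v])) => [|v w]; last first.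
    rewrite !inE => uv uw /setP/(_ v); rewrite !inE eqxx orbT.
    by case: eqP => [vu|_ /esym/eqP//]; have := F2 _ uv; rewrite vu setUid cards1.
  apply: eq_card => e; rewrite inE; apply/imsetP/andP => [[v]|[eF]].
    by rewrite inE => uv ->; rewrite set21.
  have /eqP/cards2P[a [b [_ eab]]] := F2 e eF.
  by rewrite eab in eF *; case/set2P=> ->; [exists b|exists a]; rewrite ?inE // setUC.
rewrite (eq_bigr _ (fun u _ => degree u)) exchange_big /=.
rewrite (eq_bigr (fun=> 2)) => [|e eF]; first by rewrite sum_nat_const mulnC.
by rewrite -(F2 e eF) -sum1_card [RHS]big_mkcond; apply: eq_bigr => u _; case: (u \in e).
Qed.

Lemma double_card_edges_le G : 2 * #|edges G| <= #|V| * #|V|.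
Proof.
rewrite -handshake; last exact: card_edge.
by rewrite -sum_nat_const; apply: leq_sum => u _; apply: max_card.
Qed.

Definition cut G f := [set e in edges G | 1 < #|f @: e|].

Lemma cut_sub G f : cut G f \subset edges G.
Proof. by apply/subsetP=> e; rewrite inE => /andP[]. Qed.

Lemma mem_cut G f u v : ([set u; v] \in cut G f) = adj G u v && (f u != f v).
Proof. by rewrite inE imsetU1 imset_set1 cards2; case: eqP. Qed.

(* Ordered pairs are counted, so this is twice the number of edges cut if S is a clique. *)
Definition separated_pairs f S := \sum_(u in S) #|[set v in S | f v != f u]|.

Lemma separated_pairs_split f S B : B \subset S ->
  {in B &, forall u v, f u = f v} -> {in B & S :\: B, forall u v, f u != f v} ->
  separated_pairs f S = separated_pairs f (S :\: B) + 2 * (#|B| * #|S :\: B|).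
Proof.
move=> sBS const_B sep_B; rewrite /separated_pairs (big_setID B) /= (setIidPr sBS).
have from_B u : u \in B -> #|[set v in S | f v != f u]| = #|S :\: B|.
  move=> uB; apply: eq_card => v; rewrite !inE; case vB: (v \in B).
    by rewrite (const_B v u) ?eqxx ?andbF.
  by case vS: (v \in S); rewrite //= eq_sym sep_B // inE vB.
have from_rest u : u \in S :\: B ->
    #|[set v in S | f v != f u]| = #|B| + #|[set v in S :\: B | f v != f u]|.
  move=> uSB; rewrite -cardsUI (_ : _ :&: _ = set0) ?cards0 ?addn0; last first.
    by apply/setP=> v; rewrite !inE; case: (v \in B).
  apply: eq_card => v; rewrite !inE; case vB: (v \in B) => //=.
  by rewrite (subsetP sBS v vB) /= sep_B.
rewrite (eq_bigr _ from_B) (eq_bigr _ from_rest) big_split /= !sum_nat_const; lia.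
Qed.

Lemma sum_separated_pairs G f : cluster_graph G ->
  \sum_(S in components G) separated_pairs f S = 2 * #|cut G f|.
Proof.
move=> cluster; rewrite -handshake; last first.
  by move=> e /(subsetP (cut_sub G f)); apply: card_edge.
rewrite [RHS](partition_big (component G) (mem (components G))) => [|u _] /=; last first.
  exact: component_in.
apply: eq_bigr => S SG; apply: eq_big => [u|u]; rewrite -(component_of_mem u SG) // => /eqP <-.
apply: eq_card => v; rewrite [RHS]in_set mem_cut in_set cluster_component // in_set.
by rewrite (eq_sym (f u)); case: eqP => // ->; rewrite adj_irrefl eqxx.
Qed.

Variables g1 g2 : nat.

Definition blocks_bounded f S :=
  forall u, u \in S -> g1 <= #|[set v in S | f v == f u]| <= g2.

Definition cluster_labelling G f :=
  (forall u v, f u = f v -> u != v -> adj G u v) /\ blocks_bounded f [set: V].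

Lemma deletion_labelling G F :
  cluster_graph (del_edges G F) -> card_constrained g1 g2 (del_edges G F) ->
  exists2 f, cluster_labelling G f & cut G f \subset F.
Proof.
set H := del_edges G F => cluster constrained; pose f := root (adj H).
have label_eq u v : (f u == f v) = (u \in component H v).
  by rewrite (root_connect (connect_adj_sym H)) inE connect_adj_sym.
exists f; first split=> [u v /eqP|u _].
- rewrite label_eq cluster_component // inE eq_sym => /orP[/eqP->|]; first by rewrite eqxx.
  by rewrite adj_sym adj_del_edges => /andP[].
- have -> : [set v in [set: V] | f v == f u] = component H u.
    by apply/setP=> v; rewrite !inE label_eq inE.
  by move/'forall_implyP: constrained; apply; apply: component_in.
apply/subsetP=> e; rewrite inE => /andP[eG].
have /eqP/cards2P[u [v [_ euv]]] := card_edge eG; rewrite euv in eG *.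
rewrite imsetU1 imset_set1 cards2; case: eqP => //= /eqP; rewrite label_eq inE => + _.
by apply: contraNT => uvF; rewrite connect_adj_sym connect1 // adj_del_edges uvF andbT.
Qed.

Lemma labelling_deletion G f : cluster_labelling G f ->
  cluster_graph (del_edges G (cut G f)) /\ card_constrained g1 g2 (del_edges G (cut G f)).
Proof.
case=> labels_adj bounded; set H := del_edges G _.
have adjH u v : adj H u v = adj G u v && (f u == f v).
  by rewrite adj_del_edges mem_cut; case: (adj G u v); rewrite //= negbK.
have compH u : component H u = [set v in [set: V] | f v == f u].
  apply/setP=> v; rewrite !inE; apply/idP/idP=> [|/eqP fvu].
    case/connectP=> p + ->; elim: p u => //= w p IH u.
    by rewrite adjH => /andP[/andP[_ /eqP->]]; apply: IH.
  have [-> |ne] := eqVneq v u; first exact: connect0.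
  by apply: connect1; rewrite adjH fvu eqxx labels_adj // eq_sym.
split; last by apply/'forall_implyP=> _ /imsetP[u _ ->]; rewrite compH bounded.
apply/'forall_implyP=> _ /imsetP[u _ ->]; rewrite compH.
apply/'forall_implyP=> v; rewrite !inE => /eqP fv.
apply/'forall_implyP=> w; rewrite !inE => /eqP fw; apply/implyP=> ne.
by rewrite adjH fv fw eqxx labels_adj // fv fw.
Qed.

Lemma CCClusterDeletion_labelling G k :
  CCClusterDeletion G g1 g2 k <-> exists2 f, cluster_labelling G f & #|cut G f| <= k.
Proof.
split=> [/existsP[F /and4P[_ Fk cluster constrained]]|[f lab_f cut_k]].
  have [f lab_f sub] := deletion_labelling cluster constrained.
  by exists f => //; apply: leq_trans (subset_leq_card sub) Fk.
have [cluster constrained] := labelling_deletion lab_f.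
by apply/existsP; exists (cut G f); rewrite cut_sub cut_k cluster constrained.
Qed.

End Graphs.

(** * Splitting cliques *)

(* [top] plays the role of infinity. *)
Definition least_value top (P : pred nat) (F : nat -> nat) m :=
  [/\ m <= top, forall t, P t -> m <= F t & m = top \/ exists2 t, P t & m = F t].

Lemma eq_least_value top P P' F F' m : P =1 P' -> {in P, F =1 F'} ->
  least_value top P F m -> least_value top P' F' m.
Proof.
move=> eqP eqF [le_top lower attained]; split=> // [t|]; rewrite -?eqP.
  by move=> Pt; rewrite -eqF ?lower.
by case: attained => [|[t Pt ->]]; [left|right; exists t; rewrite -?eqP ?eqF].
Qed.

Lemma least_value_upto_succ top P F m b :
  least_value top (fun t => P t && (t <= b)) F m ->
  least_value top (fun t => P t && (t <= b.+1)) F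
    (if P b.+1 then minn m (F b.+1) else m).
Proof.
case=> le_top lower attained; split=> [|t /andP[Pt]|].
- by case: ifP => _ //; rewrite geq_min le_top.
- rewrite leq_eqVlt => /orP[/eqP tb|lt]; first by rewrite -tb Pt geq_minr.
  by case: ifP => _; rewrite ?geq_min lower ?Pt.
have old : m = top \/ exists2 t, P t && (t <= b.+1) & m = F t.
  by case: attained => [|[t /andP[Pt le] ->]]; [left|right; exists t; rewrite ?Pt ?leqW].
case: ifP => // Pb; have [le|lt] := leqP m (F b.+1) => //.
by right; exists b.+1; rewrite ?Pb /=.
Qed.

Section Knapsack.
Variables g1 g2 top : nat.

Definition block_size s t := (0 < t <= s) && (g1 <= t <= g2).

Definition split_cost (D : nat -> nat) s t := D (s - t) + 2 * (t * (s - t)).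

(* The knapsack recurrence for the least number of separated pairs when s vertices
   are divided into blocks, for s <= N. *)
Definition best_table N (D : nat -> nat) :=
  D 0 = 0 /\
  forall s, 0 < s <= N -> least_value top (block_size s) (split_cost D s) (D s).

Lemma eq_split_cost D D' s t : {in gtn s, D =1 D'} -> block_size s t ->
  split_cost D s t = split_cost D' s t.
Proof.
by move=> eqD /andP[/andP[t0 ts] _]; rewrite /split_cost eqD // inE /=; lia.
Qed.

Lemma eq_best_table N D D' : {in geq N, D =1 D'} -> best_table N D -> best_table N D'.
Proof.
move=> eqD [D0 DS]; split; first by rewrite -eqD.
move=> s /andP[s0 sN]; rewrite -eqD //.
apply: (eq_least_value _ _ (DS s _)); rewrite ?s0 // => t; apply: eq_split_cost => r.
by rewrite !inE => /ltnW rs; apply: eqD; apply: leq_trans rs sN.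
Qed.

Lemma best_table_succ N D : best_table N D ->
  least_value top (block_size N.+1) (split_cost D N.+1) (D N.+1) -> best_table N.+1 D.
Proof.
move=> [D0 DS] least; split=> // s /andP[s0].
by rewrite leq_eqVlt => /orP[/eqP->|ltsN] //; apply: DS; rewrite s0.
Qed.

Lemma best_table_le_top N D s : best_table N D -> s <= N -> D s <= top.
Proof. by case=> D0 DS; case: s => [|s] le; [rewrite D0 | case: (DS s.+1)]. Qed.
End Knapsack.

Section Splitting.
Variables (V : finType) (g1 g2 : nat).
Implicit Types (f : V -> V) (S B : {set V}).
Local Notation best_table := (best_table g1 g2).
Local Notation blocks_bounded := (blocks_bounded g1 g2).

Lemma best_table_le top N D f S : best_table top N D -> #|S| <= N -> blocks_bounded f S ->
  D #|S| <= separated_pairs f S.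
Proof.
case=> D0 DS; have [m] := ubnP #|S|; elim: m S => // m IH S; rewrite ltnS => leSm leN bounded.
have [->|[u uS]] := set_0Vmem S; first by rewrite cards0 D0.
pose B := [set v in S | f v == f u].
have sBS : B \subset S by apply/subsetP=> v; rewrite inE => /andP[].
have B_gt0 : 0 < #|B| by apply/card_gt0P; exists u; rewrite inE uS eqxx.
have cardSB : #|S :\: B| = #|S| - #|B| by rewrite cardsD (setIidPr sBS).
have leBS := subset_leq_card sBS.
rewrite (separated_pairs_split (f := f) sBS) //; last 2 first.
- by move=> v w; rewrite !inE => /andP[_ /eqP->] /andP[_ /eqP->].
- move=> v w; rewrite !inE => /andP[_ /eqP->] /andP[].
  by rewrite negb_and => /orP[/negPf->//|]; rewrite eq_sym.
have [|_ /(_ #|B|) D_le _] := DS #|S|; first lia.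
apply: leq_trans (D_le _) _; first by rewrite /block_size B_gt0 leBS bounded.
rewrite /split_cost -cardSB leq_add2r; apply: IH; [lia|lia|].
move=> v; rewrite inE => /andP[vB vS].
rewrite (_ : [set w in S :\: B | _] = [set w in S | f w == f v]); first exact: bounded.
apply/setP=> w; rewrite !inE; case wS: (w \in S); rewrite ?andbF //=.
case: (f w =P f v) => [fwv|]; rewrite ?andbF //= fwv.
by move: vB; rewrite inE vS /= => ->.
Qed.

(* Labelling by elements of S keeps the labels of different cliques apart. *)
Definition good_labelling D f S :=
  [/\ {in S, forall u, f u \in S}, blocks_bounded f S & separated_pairs f S = D #|S|].

Lemma good_labelling_extend D f S B b : B \subset S -> b \in B -> g1 <= #|B| <= g2 ->
  D #|S| = split_cost D #|S| #|B| -> good_labelling D f (S :\: B) ->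
  good_labelling D (fun v => if v \in B then b else f v) S.
Proof.
move=> sBS bB size_B DS [f_in f_bounded f_cost].
have cardSB : #|S :\: B| = #|S| - #|B| by rewrite cardsD (setIidPr sBS).
have f_neq v : v \in S :\: B -> f v != b.
  by move/f_in; apply: contraTneq => ->; rewrite inE bB.
split=> [v vS|v vS|].
- case: ifP => vB; first exact: (subsetP sBS).
  by have := f_in v; rewrite !inE vB vS => /(_ isT)/andP[].
- case: ifP => vB.
    rewrite (_ : [set w in S | _] = B) //; apply/setP=> w; rewrite inE.
    case wB: (w \in B); first by rewrite eqxx (subsetP sBS).
    by case wS: (w \in S); rewrite //= (negPf (f_neq w _)) // inE wB wS.
  have vSB : v \in S :\: B by rewrite inE vB vS.
  rewrite (_ : [set w in S | _] = [set w in S :\: B | f w == f v]); first exact: f_bounded.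
  apply/setP=> w; rewrite !inE; case wB: (w \in B) => //=.
  by rewrite eq_sym (negPf (f_neq v vSB)) andbF.
rewrite (separated_pairs_split sBS) //.
- rewrite DS /split_cost -cardSB -f_cost; congr (_ + _).
  apply: eq_bigr => v; rewrite inE => /andP[/negPf vB vS].
  by apply: eq_card => w; rewrite !inE vB; case: (w \in B).
- by move=> v w -> ->.
- move=> v w vB wSB; rewrite vB; move: (wSB); rewrite inE => /andP[/negPf-> _].
  by rewrite eq_sym f_neq.
Qed.

Lemma best_table_attained top N D S :
  best_table top N D -> #|S| <= N -> D #|S| < top -> exists f, good_labelling D f S.
Proof.
case=> D0 DS; have [m] := ubnP #|S|; elim: m S => // m IH S; rewrite ltnS => leSm leN lt_top.
have [->|[u uS]] := set_0Vmem S.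
  by exists id; split=> [v|v|]; rewrite ?inE // cards0 D0 /separated_pairs big_set0.
have S_gt0 : 0 < #|S| by apply/card_gt0P; exists u.
have [|_ _ [Etop|[t /andP[tS size_t] Dt]]] := DS #|S|; [lia|by rewrite Etop ltnn in lt_top|].
have [B sBS cardB] : exists2 B : {set V}, B \subset S & #|B| = t.
  have: 0 < #|[set B : {set V} | B \subset S & #|B| == t]|.
    by rewrite cards_draws bin_gt0; lia.
  by case/card_gt0P=> B; rewrite inE => /andP[? /eqP ?]; exists B.
have [b bB] : exists b, b \in B by apply/card_gt0P; lia.
have cardSB : #|S :\: B| = #|S| - t by rewrite cardsD (setIidPr sBS) cardB.
have [|||f good_f] := IH (S :\: B); [rewrite cardSB; lia|rewrite cardSB; lia| |].
  by rewrite cardSB; apply: leq_ltn_trans lt_top; rewrite Dt leq_addr.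
exists (fun v => if v \in B then b else f v).
by apply: good_labelling_extend; rewrite ?cardB.
Qed.

End Splitting.

Section Leaves.
Variables (V : finType) (g1 g2 top : nat) (D : nat -> nat) (G H : graph V).
Hypotheses (bestD : best_table g1 g2 top #|V| D) (cluster : cluster_graph H).

Lemma component_sum_le f : cluster_labelling g1 g2 G f ->
  (forall u v, adj G u v -> f u = f v -> adj H u v) ->
  \sum_(S in components H) D #|S| <= 2 * #|cut H f|.
Proof.
move=> [labels_adj bounded] kept; rewrite -sum_separated_pairs //.
apply: leq_sum => S SH; apply: best_table_le bestD (max_card _) _ => u uS.
rewrite (_ : [set v in S | _] = [set v in [set: V] | f v == f u]); first exact: bounded.
apply/setP=> v; rewrite !inE; case: eqP; rewrite ?andbF ?andbT // => fvu.
have [-> // |ne] := eqVneq v u; move: uS; rewrite -!(component_of_mem _ SH) => /eqP <-.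
by rewrite component_eq cluster_component // inE kept ?orbT ?labels_adj // eq_sym.
Qed.

Lemma component_sum_attained : edges H \subset edges G ->
  \sum_(S in components H) D #|S| < top ->
  exists2 f, cluster_labelling g1 g2 G f & 2 * #|cut H f| = \sum_(S in components H) D #|S|.
Proof.
move=> sHG lt_top; have good S : exists f, S \in components H -> good_labelling g1 g2 D f S.
  case SH: (S \in _); last by exists id.
  have [|f] := best_table_attained bestD (max_card S); last by exists f.
  by apply: leq_ltn_trans lt_top; rewrite (bigD1 S) //= leq_addr.
have [F goodF] := fin_all_exists good; pose f u := F (component H u) u.
have f_on S u : S \in components H -> u \in S -> f u = F S u.
  by move=> SH uS; rewrite /f; move: uS; rewrite -(component_of_mem _ SH) => /eqP->.
have f_in u : f u \in component H u.
  by have [labels_in _ _] := goodF _ (component_in H u); apply/labels_in/mem_component.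
have same_component u v : f u = f v -> v \in component H u.
  move=> fuv; have := f_in u; rewrite fuv -component_eq => /eqP <-.
  by have := f_in v; rewrite -!component_eq eq_sym.
exists f.
  split=> [u v /same_component|u _].
    by rewrite cluster_component // inE => /orP[/eqP->|/(subsetP sHG)//]; rewrite eqxx.
  have [_ bounded _] := goodF _ (component_in H u).
  have := bounded u (mem_component H u).
  rewrite (_ : [set v in component H u | _] = [set v in [set: V] | f v == f u]) //.
  apply/setP=> v; rewrite !inE andTb; case vu: (v \in component H u); rewrite inE in vu.
    by rewrite vu /= -!(f_on (component H u)) ?inE ?vu ?connect0 ?component_in.
  rewrite vu /=; apply/esym/eqP=> /esym/same_component; by rewrite inE vu.
rewrite -sum_separated_pairs //; apply: eq_bigr => S SH; have [_ _ <-] := goodF _ SH.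
apply: eq_bigr => u uS; apply: eq_card => v; rewrite !inE.
by case vS: (v \in S) => //=; rewrite !(f_on S).
Qed.
End Leaves.

Section LeastVertices.
Variables (n : nat) (H : graph 'I_n).

Definition component_min (u : 'I_n) := [forall v in component H u, u <= v].

Lemma sum_components_min (F : {set 'I_n} -> nat) :
  \sum_(S in components H) F S = \sum_(u | component_min u) F (component H u).
Proof.
have min_inj : {in component_min &, injective (component H)}.
  move=> u v /forall_inP min_u /forall_inP min_v /eqP; rewrite component_eq => uv.
  apply/val_inj/eqP; rewrite eqn_leq min_v // min_u //.
  by rewrite -component_eq eq_sym component_eq.
rewrite -(big_imset _ min_inj) /=; apply: eq_bigl => S; apply/imsetP/imsetP => -[u]; last first.
  by exists u.
move=> _ ->; have [v uv min_v] := arg_minnP (@nat_of_ord n) (mem_component H u).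
have Evu : component H v = component H u by apply/eqP; rewrite component_eq.
by exists v; rewrite ?Evu //; apply/forall_inP=> w; rewrite Evu; apply: min_v.
Qed.
Lemma smaller_neighbours_eq0 u : cluster_graph H ->
  (\sum_v (adj H u v && (v < u)) == 0) = component_min u.
Proof.
move=> cluster; rewrite sum_nat_eq0; apply: eq_forallb => v.
rewrite cluster_component // inE eqb0 negb_and -leqNgt.
by case: eqP => [->|_]; rewrite ?leqnn ?orbT //= implybE.
Qed.

End LeastVertices.

(** * Branching *)

Lemma foldl_invariant (T I : Type) (P : T -> Prop) (f : T -> I -> T) s a :
  (forall a x, P a -> P (f a x)) -> P a -> P (foldl f a s).
Proof. by move=> Pf; elim: s a => //= x s IH a /Pf - /(_ x); apply: IH. Qed.

Lemma foldl_const (T I : Type) (g : T -> T) a (s : seq I) :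
  foldl (fun a _ => g a) a s = iter (size s) g a.
Proof. by elim: s a => //= x s IH a; rewrite IH -iterSr. Qed.

Section Progress.
Variables (T : Type) (measure : T -> nat).

Definition fixed_or_larger (g : T -> T) := forall a, g a = a \/ measure a < measure (g a).

Lemma fixed_or_larger_foldl (I : Type) (f : T -> I -> T) s :
  (forall x, fixed_or_larger (f^~ x)) -> fixed_or_larger (fun a => foldl f a s).
Proof.
move=> pf; elim: s => [|x s IH] a /=; first by left.
by case: (pf x a) (IH (f a x)) => [->//|lt [->|lt']]; right=> //; apply: ltn_trans lt lt'.
Qed.

Lemma foldl_fixed (I : eqType) (f : T -> I -> T) s a :
  (forall x, fixed_or_larger (f^~ x)) -> foldl f a s = a -> {in s, forall x, f a x = a}.
Proof.
move=> pf; elim: s => //= y s IH.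
have [E|lt] := pf y a; last first.
  case: (fixed_or_larger_foldl s pf (f a y)) => [->|lt'] E; first by rewrite E ltnn in lt.
  by have := ltn_trans lt lt'; rewrite E ltnn.
by rewrite E => Es x; rewrite inE => /orP[/eqP->//|]; apply: IH.
Qed.

Lemma fixed_or_larger_iter g m a : fixed_or_larger g ->
  g (iter m g a) = iter m g a \/ measure a + m <= measure (iter m g a).
Proof.
move=> pg; elim: m => [|m IH] /=; first by right; rewrite addn0.
case: IH => [E|le]; first by left; rewrite !E.
by case: (pg (iter m g a)) => [E|lt]; [left; rewrite !E | right; lia].
Qed.
End Progress.

Section Branching.
Variables (V : finType) (k g1 g2 : nat) (G : graph V).
Implicit Types H : graph V.

(* [digits] / 2^k is the binary fraction formed by the choices still to be read:
   doubling it moves the next digit into the carry. The budget is not tested during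
   the branching; it is compared with the total cost at the leaf. *)
Record node := Node { remaining : graph V; digits : nat; deleted : nat }.

Definition del_edge H u v := del_edges H [set [set u; v]].

Definition step (a : node) (u v w : V) : node :=
  let: Node H y d := a in
  if induced_P3 H u v w then
    if 2 ^ k <= y + y then Node (del_edge H u v) (y + y - 2 ^ k) d.+1
    else Node (del_edge H v w) (y + y) d.+1
  else a.

Definition pass (a : node) : node :=
  foldl (fun a u => foldl (fun a v => foldl (fun a w => step a u v w) a
    (enum V)) a (enum V)) a (enum V).

(* A pass that finds an induced path deletes an edge, so |V|^2 passes leave none. *)
Definition branch (a : node) : node :=
  foldl (fun a (_ : V) => foldl (fun a (_ : V) => pass a) a (enum V)) a (enum V).

Definition start x := Node G x 0.

Definition node_valid (a : node) :=
  [/\ edges (remaining a) \subset edges G, digits a < 2 ^ k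
    & deleted a = #|edges G :\: edges (remaining a)|].

Lemma start_valid x : x < 2 ^ k -> node_valid (start x).
Proof. by move=> ltx; split; rewrite //= setDv cards0. Qed.

Lemma deleted_le a : node_valid a -> 2 * deleted a <= #|V| * #|V|.
Proof.
case=> _ _ ->; apply: leq_trans (double_card_edges_le G).
by rewrite leq_mul2l subset_leq_card ?subsetDl ?orbT.
Qed.

Lemma step_valid a u v w : node_valid a -> node_valid (step a u v w).
Proof.
case: a => H y d [/= sHG lty ->]; rewrite /step.
have del_valid a b : adj H a b -> edges (del_edge H a b) \subset edges G /\
    #|edges G :\: edges H|.+1 = #|edges G :\: edges (del_edge H a b)|.
  move=> ab; split; first exact: subset_trans (subsetDl _ _) sHG.
  rewrite [RHS](cardsD1 [set a; b]) !inE eqxx (subsetP sHG _ ab) add1n.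
  congr _.+1; apply: eq_card => e; rewrite !inE; case: eqP => // ->.
  by rewrite -[_ \in edges H]/(adj H a b) ab.
case: ifP => [/and4P[uv vw _ _]|_]; last by split.
by case: leqP => lt; [have [] := del_valid _ _ uv | have [] := del_valid _ _ vw];
   split=> //=; lia.
Qed.

Lemma branch_valid a : node_valid a -> node_valid (branch a).
Proof. by do 5?[apply: foldl_invariant => {}a ? {}]; apply: step_valid. Qed.

Lemma step_fixed_or_larger u v w : fixed_or_larger deleted (fun a => step a u v w).
Proof.
case=> H y d; rewrite /step; case: ifP => _; last by left.
by case: ifP => _; right.
Qed.

Lemma pass_fixed_cluster a : pass a = a -> cluster_graph (remaining a).
Proof.
case: a => H y d fixed; apply: P3_free_cluster => u v w.
have larger_uv u' v' := fixed_or_larger_foldl (enum V) (step_fixed_or_larger u' v').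
have larger_u u' := fixed_or_larger_foldl (enum V) (larger_uv u').
have fixed_u := foldl_fixed larger_u fixed (etrans (mem_enum V u) isT).
have fixed_uv := foldl_fixed (larger_uv u) fixed_u (etrans (mem_enum V v) isT).
have := foldl_fixed (step_fixed_or_larger u v) fixed_uv (etrans (mem_enum V w) isT).
rewrite /step /=; case: ifP => // _.
by case: ifP => _ /(congr1 deleted)/eqP; rewrite /= -[d.+1]addn1 -{2}[d]addn0 eqn_add2l.
Qed.

Lemma branch_cluster a : node_valid a -> cluster_graph (remaining (branch a)).
Proof.
move=> valid_a; have := deleted_le (branch_valid valid_a).
have -> : branch a = iter (#|V| * #|V|) pass a.
  rewrite cardE iterM /branch foldl_const; apply: eq_iter => b.
  exact: foldl_const.
have pass_larger : fixed_or_larger deleted pass.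
  by do 3?[apply: fixed_or_larger_foldl => ?]; apply: step_fixed_or_larger.
case: (fixed_or_larger_iter (#|V| * #|V|) a pass_larger) => [/pass_fixed_cluster // | ge le].
have V0 : #|V| = 0 by nia.
by apply: P3_free_cluster => u; case: (fintype0 u V0).
Qed.

Section Guided.
Variable f : V -> V.
Hypothesis lab_f : cluster_labelling g1 g2 G f.

Definition keeps_clusters H := forall u v, adj G u v -> f u = f v -> adj H u v.

Definition within_budget H m :=
  [/\ edges H \subset edges G, keeps_clusters H, #|cut H f| <= m & m <= k].

(* The choices that follow f lead from H to some H'; the digits that make them are
   prefixed to an arbitrary continuation z'. Quantifying over z' makes the property
   compositional. *)
Definition guided (g : node -> node) := forall H m, within_budget H m ->
  exists H' m', within_budget H' m' /\ forall z', z' < 2 ^ m' ->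
  exists2 z, z < 2 ^ m &
    g (Node H (z * 2 ^ (k - m)) (k - m)) = Node H' (z' * 2 ^ (k - m')) (k - m').

Lemma guided_foldl (I : Type) (h : node -> I -> node) s :
  (forall x, guided (h^~ x)) -> guided (fun a => foldl h a s).
Proof.
move=> guided_h; elim: s => [|x s IH] H m budget.
  by exists H, m; split=> // z lt; exists z.
have [H1 [m1 [budget1 to_H1]]] := guided_h x H m budget.
have [H2 [m2 [budget2 to_H2]]] := IH H1 m1 budget1.
exists H2, m2; split=> // z2 /to_H2[z1 /to_H1[z lt Ez] Ez1].
by exists z => //=; rewrite Ez.
Qed.

Lemma within_budget_del_edge H m u v :
  within_budget H m -> [set u; v] \in cut H f ->
  exists2 m', m = m'.+1 & within_budget (del_edge H u v) m'.
Proof.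
case=> sHG keeps cut_le mk uv.
have cut_lt : #|cut (del_edge H u v) f| < #|cut H f|.
  rewrite [X in _ < X](cardsD1 [set u; v]) uv add1n ltnS subset_leq_card //.
  by apply/subsetP=> e; rewrite !inE => /andP[/andP[-> ->] ->].
exists m.-1; first lia.
split; [exact: subset_trans (subsetDl _ _) sHG | | lia | lia].
move=> a b ab fab; rewrite adj_del_edges keeps // inE; apply/eqP=> ab_uv.
by move: uv; rewrite -ab_uv mem_cut fab eqxx andbF.
Qed.

Lemma double_scaled m z : m < k -> z * 2 ^ (k - m.+1) + z * 2 ^ (k - m.+1) = z * 2 ^ (k - m).
Proof. by move=> lt; rewrite -mulnDr addnn -mul2n -expnS subnSK. Qed.

Lemma pow_scaled m : m <= k -> 2 ^ m * 2 ^ (k - m) = 2 ^ k.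
Proof. by move=> le; rewrite -expnD subnKC. Qed.

Lemma guided_step u v w : guided (fun a => step a u v w).
Proof.
move=> H m budget; have [_ keeps _ mk] := budget.
have [P3|/negPf P3] := boolP (induced_P3 H u v w); last first.
  by exists H, m; split=> // z lt; exists z; rewrite // /step P3.
have /and4P[uv vw uw nuw] := P3.
have [fuv|fuv] := eqVneq (f u) (f v); last first.
  have [|m' em budget'] := @within_budget_del_edge H m u v budget.
    by rewrite mem_cut uv.
  rewrite {}em in mk *; exists (del_edge H u v), m'; split=> // z' lt.
  exists (2 ^ m' + z'); first by rewrite expnS mul2n -addnn ltn_add2l.
  by rewrite /step /= P3 double_scaled // mulnDl (pow_scaled (ltnW mk)) leq_addr addKn subnSK.
have fvw : f v != f w.
  apply/eqP=> fvw; case/negP: nuw; apply: keeps; last by rewrite fuv.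
  by case: lab_f => labels_adj _; apply: labels_adj; rewrite // fuv.
have [|m' em budget'] := @within_budget_del_edge H m v w budget.
  by rewrite mem_cut vw.
rewrite {}em in mk *; exists (del_edge H v w), m'; split=> // z' lt; exists z'.
  by apply: leq_trans lt _; rewrite leq_exp2l.
have small : z' * 2 ^ (k - m') < 2 ^ k.
  by rewrite -(pow_scaled (ltnW mk)) ltn_pmul2r // expn_gt0.
by rewrite /step /= P3 double_scaled // leqNgt small subnSK.
Qed.

Lemma branch_guided : #|cut G f| <= k ->
  exists2 x, x < 2 ^ k & let a := branch (start x) in
    keeps_clusters (remaining a) /\ #|cut (remaining a) f| + deleted a <= k.
Proof.
move=> cut_le; have guided_branch : guided branch.
  by do 5?[apply: guided_foldl => ?]; apply: guided_step.
have [|H [m [[_ keeps cut_m mk] to_H]]] := guided_branch G k; first by split.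
have [|x ltx] := to_H 0; first by rewrite expn_gt0.
rewrite subnn expn0 muln1 => branchE; exists x => //; rewrite /start branchE.
by split=> //; rewrite -[leqRHS](subnKC mk) leq_add2r.
Qed.
End Guided.

(* Twice the number of edges deleted on the way to the leaf and within its cliques. *)
Definition leaf_cost (D : nat -> nat) (a : node) :=
  \sum_(S in components (remaining a)) D #|S| + 2 * deleted a.

Lemma branch_decides top D : 2 * k < top -> best_table g1 g2 top #|V| D ->
  CCClusterDeletion G g1 g2 k <->
  exists2 x, x < 2 ^ k & leaf_cost D (branch (start x)) <= 2 * k.
Proof.
move=> lt_top bestD; rewrite CCClusterDeletion_labelling.
split=> [[f lab_f cut_k]|[x ltx]].
  have [x ltx [keeps cost_le]] := branch_guided lab_f cut_k; exists x => //.
  have cluster := branch_cluster (start_valid ltx).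
  have := component_sum_le bestD cluster lab_f keeps; rewrite /leaf_cost; lia.
have cluster := branch_cluster (start_valid ltx).
have [] := branch_valid (start_valid ltx); move: (branch _) cluster => [H y d] /= cluster.
move=> sHG _ dE; rewrite /leaf_cost /= => cost_le.
have [|f lab_f cut_H] := component_sum_attained bestD cluster sHG.
  by apply: leq_ltn_trans lt_top; apply: leq_trans (leq_addr _ _) cost_le.
exists f => //; have sub : cut G f \subset (edges G :\: edges H) :|: cut H f.
  by apply/subsetP=> e; rewrite !inE => /andP[-> ->]; case: (e \in edges H).
apply: leq_trans (subset_leq_card sub) _.
apply: leq_trans (leq_card_setU (edges G :\: edges H) (cut H f)).1 _.
by rewrite -dE -(@leq_pmul2l 2) // mulnDr cut_H addnC.
Qed.
End Branching.

(** * The program *)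

Local Notation vSquare := 0 (only parsing).
Local Notation vSize := 1 (only parsing).
Local Notation vBudget := 2 (only parsing).
Local Notation vPower := 3 (only parsing).
Local Notation vMin := 4 (only parsing).
Local Notation vMax := 5 (only parsing).
Local Notation vAnswer := 6 (only parsing).
Local Notation vLeaf := 7 (only parsing).
Local Notation vDigits := 8 (only parsing).
Local Notation vDeleted := 9 (only parsing).
Local Notation vU := 10 (only parsing).
Local Notation vV := 11 (only parsing).
Local Notation vW := 12 (only parsing).
Local Notation vI := 13 (only parsing).
Local Notation vJ := 14 (only parsing).
Local Notation vT := 15 (only parsing).
Local Notation aRow := 0 (only parsing).
Local Notation aMatrix := 1 (only parsing).
Local Notation aBest := 2 (only parsing).

Definition nvars := 16.
Definition narrays := 3.

Local Notation "c1 ;; c2" := (Then c1 c2) (at level 90, right associativity).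
Local Notation "e1 |+| e2" := (Plus e1 e2) (at level 50, left associativity).
Local Notation "e1 |-| e2" := (Minus e1 e2) (at level 50, left associativity).
Local Notation "$ i" := (Var i) (at level 9, format "$ i").

Definition when e c := Cond e c Nop.
Definition unless e c := Cond e Nop c.
Definition bump z e := Assign z ($z |+| e).
Definition each i c := For Linear i vSize c.

Definition load_params :=
  Assign vSize (Read (Lit 0)) ;; Assign vMin (Read (Lit 1)) ;;
  Assign vMax (Read (Lit 2)) ;; Assign vBudget (Read (Lit 3)).

Definition make_square := each vU (bump vSquare $vSize).

Definition make_power :=
  Assign vPower (Lit 1) ;; For Exponential vU vBudget (bump vPower $vPower).

Definition make_rows :=
  Assign vT (Lit 0) ;; each vU (Put aRow $vU $vT ;; bump vT $vSize).

Definition initialize := load_params ;; make_square ;; make_power ;; make_rows.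

(* The candidate is the split cost for s = vU + 1 and t = vV + 1. *)
Definition make_product :=
  Assign vT ($vV |+| Lit 1) ;; Assign vW (Lit 0) ;;
  For Linear vJ vT (bump vW (($vU |-| $vV) |+| ($vU |-| $vV))).

Definition candidate := Item aBest ($vU |-| $vV) |+| $vW.

Definition try_block :=
  unless (($vV |-| $vU) |+| ($vMin |-| ($vV |+| Lit 1)) |+| (($vV |+| Lit 1) |-| $vMax))
    (make_product ;; when ($vI |-| candidate) (Assign vI candidate)).

Definition find_best := Assign vI ($vPower |+| $vPower) ;; each vV try_block.

Definition make_best := each vU (find_best ;; Put aBest ($vU |+| Lit 1) $vI).

Definition cell u v := Item aRow $u |+| $v.
Definition distance u v := ($u |-| $v) |+| ($v |-| $u).

(* The diagonal is cleared rather than copied, since it holds variables. *)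
Definition copy_cell :=
  Cond (distance vU vV) (Put aMatrix (cell vU vV) (Read (Lit 4 |+| cell vU vV)))
                        (Put aMatrix (cell vU vV) (Lit 0)).

Definition copy_matrix := each vU (each vV copy_cell).

Definition remove_edge u v :=
  Put aMatrix (cell u v) (Lit 0) ;; Put aMatrix (cell v u) (Lit 0).

Definition when_P3 c :=
  when (Item aMatrix (cell vU vV)) (when (Item aMatrix (cell vV vW))
    (when (distance vU vW) (unless (Item aMatrix (cell vU vW)) c))).

Definition read_digit :=
  bump vDigits $vDigits ;;
  Cond ($vPower |-| $vDigits) (remove_edge vV vW)
    (Assign vDigits ($vDigits |-| $vPower) ;; remove_edge vU vV).

Definition choose_edge := read_digit ;; bump vDeleted (Lit 1).

Definition run_branch :=
  each vI (each vJ (each vU (each vV (each vW (when_P3 choose_edge))))).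

Definition count_component :=
  Assign vJ (Lit 1) ;; each vV (when (Item aMatrix (cell vU vV)) (bump vJ (Lit 1))).

Definition count_smaller :=
  Assign vT (Lit 0) ;;
  each vV (when (Item aMatrix (cell vU vV)) (when ($vU |-| $vV) (bump vT (Lit 1)))).

(* A clique is charged at its least vertex. *)
Definition charge_vertex :=
  count_component ;; count_smaller ;; unless $vT (bump vI (Item aBest $vJ)).

Definition sum_best := Assign vI (Lit 0) ;; each vU charge_vertex.

Definition try_leaf :=
  Assign vDigits $vLeaf ;; Assign vDeleted (Lit 0) ;;
  copy_matrix ;; run_branch ;; sum_best ;;
  unless (($vI |+| ($vDeleted |+| $vDeleted)) |-| ($vBudget |+| $vBudget))
    (Assign vAnswer (Lit 1)).

Definition solver := initialize ;; make_best ;; For Exponential vLeaf vPower try_leaf.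

Lemma solver_wf : wf_prog nvars narrays solver.
Proof. by vm_compute. Qed.

Lemma row_major_lt m n (u : 'I_m) (v : 'I_n) : u * n + v < m * n.
Proof.
by have := leq_mul (ltn_ord u) (leqnn n); have := ltn_ord v; rewrite mulSn; lia.
Qed.

Lemma row_major_inj m n (u u' : 'I_m) (v v' : 'I_n) :
  (u * n + v == u' * n + v') = (u == u') && (v == v').
Proof.
apply/eqP/andP => [E|[/eqP-> /eqP->//]]; have n_gt0 := leq_ltn_trans (leq0n v) (ltn_ord v).
have Eu : u = u'.
  apply: val_inj; move: (congr1 (divn^~ n) E).
  by rewrite /= !divnMDl // !divn_small // !addn0.
by split; apply/eqP=> //; apply: val_inj; move: E; rewrite Eu => /addnI.
Qed.

Section Solver.
Variables (n g1 g2 k : nat) (G : graph 'I_n).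
Local Notation V := 'I_n.
Implicit Types (H : graph V) (u v w : V) (s : state) (Q : state -> Prop).

Definition max_value := 2 ^ k * (n + g1 + g2 + 2) ^ 3.
Definition max_iter (r : range) := if r is Linear then n.+1 else 2 ^ k.

Local Notation inp := (input G g1 g2 k).
Local Notation wp := (wp inp n max_value max_iter (readable nvars n)).
Local Notation denotes := (denotes inp n (readable nvars n)).
Local Notation top := (2 ^ k + 2 ^ k).
Local Notation best_table := (best_table g1 g2 top).

Lemma max_value_ge_poly : 2 * (n * n) + n + g1 + g2 + 1 <= max_value.
Proof.
have pow_gt0 : 0 < 2 ^ k by rewrite expn_gt0.
by apply: leq_trans (leq_pmull ((n + g1 + g2 + 2) ^ 3) pow_gt0); rewrite !expnS expn0; nia.
Qed.

Lemma max_value_ge_exp : n.+1 * top <= max_value.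
Proof.
have -> : n.+1 * top = 2 ^ k * (n.+1 * 2) by lia.
by rewrite /max_value leq_mul // !expnS expn0; nia.
Qed.

Lemma budget_lt : k < 2 ^ k.
Proof. exact: ltn_expl. Qed.

Lemma top_le_max : top <= max_value.
Proof. by apply: leq_trans max_value_ge_exp; rewrite leq_pmull. Qed.

(** ** Proof rules *)

Lemma wp_bump z e x y Q s :
  vars s z = x -> denotes s e y -> x + y <= max_value -> Q (set_var z (x + y) s) ->
  wp (bump z e) Q s.
Proof. by move=> <- [def <-] le q; apply: wp_assign q. Qed.

Lemma wp_when e x c Q s :
  denotes s e x -> (if x == 0 then Q s else wp c Q s) -> wp (when e c) Q s.
Proof. by move=> ex q; apply: wp_cond ex _; case: ifP q => // _ q; apply: wp_nop. Qed.

Lemma wp_unless e x c Q s :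
  denotes s e x -> (if x == 0 then wp c Q s else Q s) -> wp (unless e c) Q s.
Proof. by move=> ex q; apply: wp_cond ex _; case: ifP q => // _ q; apply: wp_nop. Qed.

Lemma wp_each i c (Inv : nat -> state -> Prop) Q s :
  vars s vSize = n -> Inv 0 s ->
  (forall j s', j < n -> Inv j s' -> unchanged_by (each i c) s (set_var i j s') ->
    wp c (Inv j.+1) (set_var i j s')) ->
  (forall s', Inv n s' -> unchanged_by (each i c) s (set_var i n s') ->
    Q (set_var i n s')) ->
  wp (each i c) Q s.
Proof. by move=> sz; apply: wp_for sz (leqnSn n : n <= max_iter Linear). Qed.

Lemma wp_each_vertex i c (Inv : seq V -> state -> Prop) Q s :
  vars s vSize = n -> Inv [::] s ->
  (forall l u r s', enum V = l ++ u :: r -> Inv l s' ->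
    unchanged_by (each i c) s (set_var i u s') -> wp c (Inv (rcons l u)) (set_var i u s')) ->
  (forall s', Inv (enum V) s' -> Q (set_var i n s')) ->
  wp (each i c) Q s.
Proof.
move=> sz Inv0 InvS Q_end; apply: (wp_each (Inv := fun j s' => Inv (take j (enum V)) s')) => //.
- by rewrite take0.
- move=> j s' ltj Ij S; pose u := Ordinal ltj.
  have enum_u : nth u (enum V) j = u := nth_ord_enum u u.
  have lt_size : j < size (enum V) by rewrite size_enum_ord.
  rewrite (take_nth u) // enum_u; apply: (InvS _ _ (drop j.+1 (enum V))) => //.
  by rewrite -{1}enum_u -drop_nth // cat_take_drop.
by move=> s'; rewrite take_oversize ?size_enum_ord // => Inv_enum _; apply: Q_end.
Qed.

Lemma wp_foldl (T : Type) (R : T -> state -> Prop) (f : T -> V -> T) i c a s :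
  vars s vSize = n -> R a s ->
  (forall a s j, R a s -> R a (set_var i j s)) ->
  (forall u a s', R a s' -> vars s' i = u -> unchanged_by (each i c) s s' ->
    wp c (R (f a u)) s') ->
  wp (each i c) (R (foldl f a (enum V))) s.
Proof.
move=> sz Ra R_set R_step.
apply: (wp_each_vertex (Inv := fun l s' => R (foldl f a l) s')) => //; last first.
  by move=> s' Rs; apply: R_set.
move=> l u r s' _ Rl S; rewrite foldl_rcons; apply: R_step => //; first exact: R_set.
by rewrite /= eqxx.
Qed.

Lemma wp_sum (F : V -> nat) i z c m s :
  vars s vSize = n -> z != i -> vars s z = m -> m + \sum_u F u <= max_value ->
  (forall u x s', x + F u <= max_value -> vars s' z = x -> vars s' i = u ->
    unchanged_by (each i c) s s' -> wp c (fun s'' => vars s'' z = x + F u) s') ->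
  wp (each i c) (fun s' => vars s' z = m + \sum_u F u) s.
Proof.
move=> sz /negPf neq_z zm le_max F_step.
apply: (wp_each_vertex (Inv := fun l s' => vars s' z = m + \sum_(u <- l) F u)) => //.
- by rewrite big_nil addn0.
- move=> l u r s' enumE zl S; rewrite big_rcons addnA.
  apply: F_step; rewrite //= ?neq_z ?eqxx //.
  apply: leq_trans le_max; rewrite -addnA leq_add2l -big_enum enumE big_cat big_cons /=.
  by rewrite addnA leq_addr.
- by move=> s' zn; rewrite /= neq_z zn big_enum.
Qed.

(** ** Initialisation *)

Definition zero_state := State (fun=> 0) (fun _ _ => 0).

Lemma wp_load_params :
  wp load_params (fun s => [/\ vars s vSize = n, vars s vMin = g1, vars s vMax = g2
    & vars s vBudget = k]) zero_state.
Proof.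
have param (a : nat) s : a < 4 -> denotes s (Read (Lit a)) (inp a).
  by move=> lt; do 2!split=> //; apply: readable_param.
have poly := max_value_ge_poly; have pow := top_le_max; have lt_k := budget_lt.
apply: wp_seq; apply: wp_assign (param 0 _ _) _ _ => //=; first lia.
apply: wp_seq; apply: wp_assign (param 1 _ _) _ _ => //=; first lia.
apply: wp_seq; apply: wp_assign (param 2 _ _) _ _ => //=; first lia.
by apply: wp_assign (param 3 _ _) _ _ => //=; lia.
Qed.

Lemma wp_square s : vars s vSize = n -> vars s vSquare = 0 ->
  wp make_square (fun s' => vars s' vSquare = n * n) s.
Proof.
move=> sz sq0; have sum_n : \sum_(u : V) n = n * n by rewrite sum_nat_const card_ord.
rewrite -[n * n]add0n -sum_n; apply: wp_sum => //.
  by rewrite sum_n add0n; have := max_value_ge_poly; lia.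
move=> u x s' le vx _ [V_eq _]; apply: wp_bump le _; rewrite ?vx //.
by split; rewrite //= V_eq.
Qed.

Lemma wp_power s : vars s vBudget = k -> wp make_power (fun s' => vars s' vPower = 2 ^ k) s.
Proof.
move=> vk; apply: wp_seq; apply: (wp_assign (x := 1)) => //.
  by have := max_value_ge_poly; lia.
apply: (wp_for (m := k) (Inv := fun j s' => vars s' vPower = 2 ^ j)) => //.
  exact/ltnW/budget_lt.
move=> j s' ltj vj _; apply: (wp_bump (x := 2 ^ j) (y := 2 ^ j)) => //.
  apply: leq_trans (leq_trans (leq_addr _ _) top_le_max).
  by rewrite addnn -mul2n -expnS leq_exp2l.
by rewrite /= expnS mul2n addnn.
Qed.

Lemma wp_rows s : vars s vSize = n -> vars s vSquare = n * n ->
  wp make_rows (fun s' => forall u, u < n -> arrays s' aRow u = u * n) s.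
Proof.
move=> sz sq; have poly := max_value_ge_poly.
apply: wp_seq; apply: (wp_assign (x := 0)) => //.
apply: (wp_each (Inv := fun j s' =>
  vars s' vT = j * n /\ forall u, u < j -> arrays s' aRow u = u * n)) => //; last first.
  by move=> s' [_].
move=> j s1 ltj [vj rows] [V_eq _]; have le_row : j * n + n <= n * n by nia.
apply: wp_seq; apply: (wp_put (j := j) (x := j * n)) => //; try lia.
  by split; rewrite ?V_eq // /capacity; lia.
apply: (wp_bump (x := j * n) (y := n)) => //; last 2 first.
- by lia.
- split=> [|u] /=; first by rewrite mulSn addnC.
  by rewrite ltnS leq_eqVlt; case: eqP => [-> // | _ /rows].
by split=> //; apply: etrans (V_eq vSize isT) sz.
Qed.

Record initialized (s : state) : Prop := Initialized {
  square_var : vars s vSquare = n * n;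
  size_var : vars s vSize = n;
  budget_var : vars s vBudget = k;
  power_var : vars s vPower = 2 ^ k;
  min_var : vars s vMin = g1;
  max_var : vars s vMax = g2;
  row_array : forall u, u < n -> arrays s aRow u = u * n
}.

Lemma wp_initialize : wp initialize
  (fun s => [/\ initialized s, vars s vAnswer = 0 & arrays s aBest 0 = 0]) zero_state.
Proof.
apply: wp_then wp_load_params _ => s1 [sz1 min1 max1 bud1] [V1 A1].
apply: (wp_then (wp_square sz1 _)); rewrite ?V1 // => s2 sq2 [V2 A2].
apply: (wp_then (wp_power _)); rewrite ?V2 // => s3 pow3 [V3 A3].
have sz3 : vars s3 vSize = n by rewrite V3 // V2.
have sq3 : vars s3 vSquare = n * n by rewrite V3.
apply: wp_consequence (wp_rows sz3 sq3) _ => s4 rows4 [V4 A4].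
by split; [split|..]; rewrite ?V4 // ?V3 // ?V2 // ?V1 // A4 // A3 // A2 // A1.
Qed.

Lemma initialized_unchanged vs bs s s' : all (leq 6) vs -> all (leq 1) bs ->
  unchanged_outside vs bs s s' -> initialized s -> initialized s'.
Proof.
move=> /allP le_vs /allP le_bs [V_eq A_eq] [e0 e1 e2 e3 e4 e5 rows].
have notin z : z < 6 -> z \notin vs.
  by move=> lt; apply/negP=> /le_vs; rewrite leqNgt lt.
have row_notin : 0 \notin bs by apply/negP=> /le_bs.
by split; rewrite ?V_eq ?notin // => u ltu; rewrite A_eq // rows.
Qed.

Lemma initialized_set_var i x s : 5 < i -> initialized s -> initialized (set_var i x s).
Proof.
move=> lti; apply: initialized_unchanged (unchanged_set_var i [::] [::] x s) => //=.
by rewrite andbT.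
Qed.

Lemma initialized_set_item a j x s : 0 < a -> initialized s -> initialized (set_item a j x s).
Proof.
move=> lta; apply: initialized_unchanged (unchanged_set_item a j [::] [::] x s) => //=.
by rewrite andbT.
Qed.

Lemma initialized_addressable s j : initialized s -> j < capacity n -> addressable n s j.
Proof. by move=> init ltj; split; rewrite ?(square_var init). Qed.

(** ** The table of the knapsack recurrence *)

Lemma wp_product s a b : vars s vU = a -> vars s vV = b -> b <= a < n ->
  wp make_product (fun s' => vars s' vW = 2 * (b.+1 * (a - b))) s.
Proof.
move=> va vb /andP[ba an]; have poly := max_value_ge_poly; pose d := a - b.
have le_max j : j <= b.+1 -> j * (d + d) <= max_value.
  move=> lej; apply: (@leq_trans (n * (n + n))); last by lia.
  by rewrite leq_mul // /d; lia.
apply: wp_seq; apply: (wp_assign (x := b + 1)); first by apply: denotes_plus (denotes_var vb) _.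
  by lia.
apply: wp_seq; apply: (wp_assign (x := 0)) => //.
apply: (wp_for (m := b.+1) (Inv := fun j s' => vars s' vW = j * (d + d))) => //.
- by rewrite /= addn1.
- by rewrite /=; lia.
- move=> j s1 ltj vj [V_eq _].
  apply: (wp_bump (x := j * (d + d)) (y := d + d)) => //; rewrite -?mulSnr ?le_max //.
  by do 2?apply: denotes_plus; apply: denotes_minus; apply: denotes_var; rewrite V_eq.
by move=> s1 /= -> _; rewrite addnn -mul2n mulnCA.
Qed.

Lemma wp_try_block s a b m : initialized s -> vars s vU = a -> vars s vV = b ->
  vars s vI = m -> a < n -> m <= max_value ->
  wp try_block (fun s' => vars s' vI = if block_size g1 g2 a.+1 b.+1
    then minn m (split_cost (arrays s aBest) a.+1 b.+1) else m) s.
Proof.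
move=> init va vb vm lta le_max.
apply: (wp_unless (x := b - a + (g1 - b.+1) + (b.+1 - g2))).
  by split; rewrite //= va vb (min_var init) (max_var init) addn1.
have -> : (b - a + (g1 - b.+1) + (b.+1 - g2) == 0) = block_size g1 g2 a.+1 b.+1.
  by rewrite /block_size; lia.
case size_b: (block_size g1 g2 a.+1 b.+1) => //; have /andP[/andP[_ leb] _] := size_b.
have le_ba : b <= a < n by rewrite -ltnS leb.
apply: wp_then (wp_product va vb le_ba) _ => s1 product S1; have [V_eq A_eq] := S1.
set x := split_cost _ _ _.
have init1 : initialized s1 by apply: initialized_unchanged S1 init.
have candidate_x : denotes s1 candidate x.
  split; last by rewrite /= product A_eq // !V_eq // va vb.
  split=> //; split=> //; apply: initialized_addressable => //=.
  by rewrite !V_eq // va vb /capacity; lia.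
apply: (wp_when (x := m - x)).
  by case: candidate_x => def <-; split; rewrite //= V_eq // vm.
rewrite subn_eq0; case: leqP => [_|lt]; first by rewrite V_eq.
by apply: wp_assign candidate_x _ _ => //; lia.
Qed.

Lemma wp_find_best s a : initialized s -> vars s vU = a -> a < n ->
  wp find_best (fun s' => least_value top (block_size g1 g2 a.+1)
    (split_cost (arrays s aBest) a.+1) (vars s' vI)) s.
Proof.
move=> init va lta; have le_top := top_le_max.
apply: wp_seq; apply: (wp_assign (x := top)) => //.
  by split; rewrite //= (power_var init).
set s1 := set_var _ _ _; have init1 : initialized s1 by apply: initialized_set_var.
apply: (wp_each (Inv := fun b s' => least_value top
  (fun t => block_size g1 g2 a.+1 t && (t <= b)) (split_cost (arrays s aBest) a.+1)
  (vars s' vI))).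
- exact: size_var init1.
- by split=> [|[|t] /andP[]|] //; left.
- move=> b s2 ltb least; set s3 := set_var vV b s2 => S3.
  have init3 : initialized s3 by apply: initialized_unchanged S3 init1.
  have va3 : vars s3 vU = a by rewrite S3.1.
  have best3 : arrays s3 aBest =1 arrays s aBest by apply: S3.2.
  have le_max : vars s3 vI <= max_value by case: least => le _ _; apply: leq_trans le le_top.
  apply: wp_consequence (wp_try_block init3 va3 erefl erefl lta le_max) _ => s4 -> _.
  by rewrite /split_cost best3; apply: least_value_upto_succ least.
move=> s2 least _; apply: (eq_least_value _ _ least) => // t.
by rewrite /block_size; lia.
Qed.

Lemma wp_make_best s : initialized s -> arrays s aBest 0 = 0 ->
  wp make_best (fun s' => best_table n (arrays s' aBest)) s.
Proof.
move=> init best0; apply: (wp_each (Inv := fun a s' => best_table a (arrays s' aBest))).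
- exact: size_var init.
- by split=> // r; lia.
- move=> a s1 lta best1; set s2 := set_var vU a s1 => S2.
  have init2 : initialized s2 by apply: initialized_unchanged S2 init.
  apply: wp_then (wp_find_best init2 erefl lta) _ => s3 least S3.
  have [V_eq A_eq] := S3.
  have init3 : initialized s3 by apply: initialized_unchanged S3 init2.
  apply: (wp_put (j := a.+1) (x := vars s3 vI)) => //.
  + by split; rewrite //= V_eq //= addn1.
  + by apply: initialized_addressable; rewrite // /capacity; nia.
  + by case: least => le _ _; apply: leq_trans le top_le_max.
  have before r : r <= a -> arrays s1 aBest r =
      arrays (set_item aBest a.+1 (vars s3 vI) s3) aBest r.
    by move=> le /=; rewrite A_eq // ifF //; apply/eqP; lia.
  apply: best_table_succ; first by apply: eq_best_table best1 => r; apply: before.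
  rewrite [X in least_value _ _ _ X]/= eqxx.
  apply: eq_least_value least => // t; apply: eq_split_cost => r.
  by rewrite inE /= ltnS; apply: before.
by move=> s1 best1 _.
Qed.

(** ** The search tree *)

Lemma input_cell u v : inp (4 + (u * n + v)) = adj G u v.
Proof.
rewrite /input /=; congr nat_of_bool; apply/existsP/idP => [[a /existsP[b]]|uv].
  by rewrite row_major_inj => /andP[/andP[/eqP-> /eqP->]].
by exists u; apply/existsP; exists v; rewrite eqxx.
Qed.

Lemma var_addr_diagonal i u v : var_addr n i = 4 + (u * n + v) -> u = v.
Proof.
move/addnI => iuv; have lt_i : i < n by have := row_major_lt u v; rewrite -iuv; nia.
have : Ordinal lt_i * n + Ordinal lt_i == u * n + v by rewrite -iuv mulnS addnC.
by rewrite row_major_inj => /andP[/eqP<- /eqP<-].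
Qed.

Lemma readable_cell u v : u != v -> readable nvars n (4 + (u * n + v)).
Proof.
move=> uv; split=> [|i _ /esym/var_addr_diagonal Euv].
  by rewrite ltn_add2l row_major_lt.
by rewrite Euv eqxx in uv.
Qed.

Lemma denotes_cell s i j u v : initialized s -> vars s i = u -> vars s j = v ->
  denotes s (cell i j) (u * n + v).
Proof.
move=> init vu vv; have ltu := ltn_ord u; split; last by rewrite /= vu vv (row_array init).
by split=> //; split=> //; apply: initialized_addressable; rewrite //= vu /capacity; lia.
Qed.

Lemma cell_addressable s u v : initialized s -> addressable n s (u * n + v).
Proof.
move=> init; apply: initialized_addressable => //.
by have := row_major_lt u v; rewrite /capacity; lia.
Qed.

Lemma denotes_distance s i j u v : vars s i = u -> vars s j = v ->
  denotes s (distance i j) ((u - v) + (v - u)).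
Proof. by move=> vu vv; split; rewrite //= vu vv. Qed.

Lemma distance_eq0 u v : ((u - v) + (v - u) == 0) = (u == v).
Proof. by rewrite -val_eqE /=; lia. Qed.

Definition copied m s := forall u v, u * n + v < m ->
  arrays s aMatrix (u * n + v) = adj G u v.

Lemma copied_succ s u v : copied (u * n + v) s ->
  copied (u * n + v.+1) (set_item aMatrix (u * n + v) (adj G u v) s).
Proof.
move=> copied_s a b; rewrite addnS ltnS leq_eqVlt /= row_major_inj.
by case: andP => [[/eqP-> /eqP->] //|_ /=]; apply: copied_s.
Qed.

Lemma wp_copy_cell s u v : initialized s -> vars s vU = u -> vars s vV = v ->
  copied (u * n + v) s -> wp copy_cell (copied (u * n + v.+1)) s.
Proof.
move=> init vu vv /copied_succ copied_s.
have cell_uv := denotes_cell init vu vv; have [def val] := cell_uv.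
apply: wp_cond (denotes_distance vu vv) _; rewrite distance_eq0; case: eqP => [uv|/eqP uv].
  apply: wp_put cell_uv (cell_addressable _ _ init) (_ : denotes _ _ 0) _ _ => //.
  by move: copied_s; rewrite -{3}uv adj_irrefl.
apply: wp_put cell_uv (cell_addressable _ _ init) _ _ copied_s.
  split; last by rewrite -input_cell -val.
  split=> //; rewrite -[value _ _ _]/(4 + value inp s (cell vU vV)) val.
  exact: readable_cell.
by apply: leq_trans (leq_b1 _) _; have := max_value_ge_poly; lia.
Qed.

Definition stores_graph H s :=
  initialized s /\ forall u v, arrays s aMatrix (u * n + v) = adj H u v.

Lemma stores_graph_unchanged vs bs s s' H : all (leq 6) vs -> all (leq 2) bs ->
  unchanged_outside vs bs s s' -> stores_graph H s -> stores_graph H s'.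
Proof.
move=> le_vs le_bs S [init sH]; split.
  apply: initialized_unchanged S init => //.
  by apply: sub_all le_bs => b; apply: ltnW.
by move=> u v; rewrite S.2 //; apply/negP=> /(allP le_bs).
Qed.

Lemma stores_graph_set_var i x s H : 5 < i -> stores_graph H s -> stores_graph H (set_var i x s).
Proof. by move=> lti [init sH]; split=> //; apply: initialized_set_var. Qed.

Lemma denotes_adj s i j u v H : stores_graph H s ->
  vars s i = u -> vars s j = v -> denotes s (Item aMatrix (cell i j)) (adj H u v).
Proof.
move=> [init sH] vu vv; have [def val] := denotes_cell init vu vv.
split; last by rewrite /= -[_ + _]/(value inp s (cell i j)) val.
by split=> //; rewrite val; apply: cell_addressable.
Qed.

Lemma wp_copy s : initialized s -> wp copy_matrix (stores_graph G) s.
Proof.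
move=> init; apply: (wp_each (Inv := fun a => copied (a * n))); first exact: size_var init.
- by [].
- move=> a s1 lta copied1; set s2 := set_var vU a s1 => S2.
  have init2 : initialized s2 by apply: initialized_unchanged S2 init.
  apply: (wp_each (Inv := fun b => copied (a * n + b))); first exact: size_var init2.
  + by move=> u v; rewrite addn0; apply: copied1.
  + move=> b s3 ltb copied3; set s4 := set_var vV b s3 => S4.
    have init4 : initialized s4 by apply: initialized_unchanged S4 init2.
    have va : vars s4 vU = Ordinal lta by rewrite S4.1.
    exact: wp_copy_cell init4 va (erefl : vars s4 vV = Ordinal ltb) copied3.
  by move=> s3 copied3 _; rewrite mulSnr.
move=> s1 copied1 S1; split; first exact: initialized_unchanged S1 init.
by move=> u v; apply: copied1; apply: row_major_lt.
Qed.

Lemma wp_remove_edge s i j u v H : stores_graph H s -> vars s i = u -> vars s j = v ->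
  wp (remove_edge i j) (stores_graph (del_edge H u v)) s.
Proof.
move=> [init sH] vu vv; apply: wp_seq.
apply: (wp_put (x := 0) (denotes_cell init vu vv) (cell_addressable u v init)) => //.
set s1 := set_item _ _ _ _; have init1 : initialized s1 by apply: initialized_set_item.
apply: (wp_put (x := 0) (denotes_cell init1 vv vu) (cell_addressable v u init1)) => //.
split; first exact: initialized_set_item.
move=> a b; rewrite adj_del_edges inE set2_eq /= !row_major_inj sH.
by case: (a == u); case: (b == v); case: (a == v); case: (b == u); rewrite /= ?andbT ?andbF.
Qed.

Definition represents_node (a : node V) s :=
  [/\ stores_graph (remaining a) s, vars s vDigits = digits a, vars s vDeleted = deleted a
    & node_valid k G a].

Lemma represents_node_set_var a s i x : 9 < i ->
  represents_node a s -> represents_node a (set_var i x s).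
Proof.
move=> lt [sH vy vd valid]; split=> //=; first by apply: stores_graph_set_var => //; lia.
  by rewrite ifF //; apply/eqP; lia.
by rewrite ifF //; apply/eqP; lia.
Qed.

Lemma wp_when_P3 c Q s u v w H : stores_graph H s ->
  vars s vU = u -> vars s vV = v -> vars s vW = w ->
  (if induced_P3 H u v w then wp c Q s else Q s) -> wp (when_P3 c) Q s.
Proof.
move=> sH vu vv vw; rewrite /induced_P3.
case uv: (adj H u v) => /= q; apply: wp_when (denotes_adj sH vu vv) _; rewrite uv //=.
move: q; case vw': (adj H v w) => /= q; apply: wp_when (denotes_adj sH vv vw) _;
  rewrite vw' //=.
apply: wp_when (denotes_distance vu vw) _; rewrite distance_eq0; case: eqP q => //= _ q.
by apply: wp_unless (denotes_adj sH vu vw) _; case: (adj H u w) q.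
Qed.

Lemma wp_read_digit s H y u v w : stores_graph H s -> vars s vDigits = y -> y < 2 ^ k ->
  vars s vU = u -> vars s vV = v -> vars s vW = w ->
  wp read_digit (fun s' => if 2 ^ k <= y + y
    then stores_graph (del_edge H u v) s' /\ vars s' vDigits = y + y - 2 ^ k
    else stores_graph (del_edge H v w) s' /\ vars s' vDigits = y + y) s.
Proof.
move=> sH vy lty vu vv vw; have le_top := top_le_max; have [init _] := sH.
apply: wp_seq; apply: (wp_bump (x := y) (y := y)) => //; first lia.
set s1 := set_var _ _ _; have sH1 : stores_graph H s1 by apply: stores_graph_set_var.
apply: (wp_cond (x := 2 ^ k - (y + y))); first by split; rewrite //= (power_var init).
rewrite subn_eq0; case: leqP => [le|lt]; last first.
  apply: wp_consequence (wp_remove_edge (i := vV) (j := vW) sH1 vv vw) _.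
  by move=> s2 sH2 [V_eq _]; rewrite V_eq.
apply: wp_seq; apply: (wp_assign (x := y + y - 2 ^ k)); last 2 first.
- by lia.
- set s2 := set_var _ _ _; have sH2 : stores_graph H s2 by apply: stores_graph_set_var.
  apply: wp_consequence (wp_remove_edge (i := vU) (j := vV) sH2 vu vv) _.
  by move=> s3 sH3 [V_eq _]; rewrite V_eq.
by split; rewrite //= (power_var init).
Qed.

Lemma wp_choose_edge a s u v w : represents_node a s ->
  vars s vU = u -> vars s vV = v -> vars s vW = w -> induced_P3 (remaining a) u v w ->
  wp choose_edge (represents_node (step k a u v w)) s.
Proof.
case: a => H y d [/= sH vy vd valid] vu vv vw P3.
have valid' := step_valid u v w valid; have [_ lty _] := valid.
have le_d : d.+1 <= max_value.
  have := deleted_le valid'; have := max_value_ge_poly; rewrite card_ord /= P3.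
  by case: ifP => _ /=; lia.
rewrite /= P3 in valid' *.
apply: wp_then (wp_read_digit sH vy lty vu vv vw) _ => s1 + S1.
case: ifP valid' => _ valid' [sH1 vy1];
  (apply: (wp_bump (x := d) (y := 1)); rewrite ?addn1 //; first by rewrite S1.1);
  by split=> //; apply: stores_graph_set_var.
Qed.

Lemma wp_step a s u v w : represents_node a s ->
  vars s vU = u -> vars s vV = v -> vars s vW = w ->
  wp (when_P3 choose_edge) (represents_node (step k a u v w)) s.
Proof.
move=> rep vu vv vw; have [sH _ _ _] := rep.
apply: (wp_when_P3 sH vu vv vw); case: ifP => P3; first exact: wp_choose_edge.
by case: a rep P3 {sH} => H y d rep /= ->.
Qed.

Lemma wp_each_node (f : node V -> V -> node V) i c a s :
  9 < i -> represents_node a s ->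
  (forall u a s', represents_node a s' -> vars s' i = u -> unchanged_by (each i c) s s' ->
    wp c (represents_node (f a u)) s') ->
  wp (each i c) (represents_node (foldl f a (enum V))) s.
Proof.
move=> lt rep rep_step; apply: wp_foldl => //; first by case: rep => -[/size_var].
by move=> a' s' j; apply: represents_node_set_var.
Qed.

Lemma wp_run_branch a s : represents_node a s ->
  wp run_branch (represents_node (branch k a)) s.
Proof.
move=> rep; apply: wp_each_node => // _ {rep}a {}s rep _ _.
apply: wp_each_node => // _ {rep}a {}s rep _ _.
apply: wp_each_node => // u {rep}a {}s rep vu _.
apply: wp_each_node => // v {rep}a s1 rep vv [V1 _].
apply: wp_each_node => // w {rep}a s2 rep vw [V2 _].
by apply: wp_step; rewrite // V2 // V1.
Qed.

(** ** The leaves *)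

Lemma wp_count_component s u H : stores_graph H s -> cluster_graph H -> vars s vU = u ->
  wp count_component (fun s' => vars s' vJ = #|component H u|) s.
Proof.
move=> sH cluster vu; have poly := max_value_ge_poly.
apply: wp_seq; apply: (wp_assign (x := 1)) => //; first lia.
set s1 := set_var _ _ _; have sH1 : stores_graph H s1 by apply: stores_graph_set_var.
rewrite card_cluster_component //; apply: wp_sum => //; first by case: sH1 => /size_var.
  by apply: leq_trans (leq_add (leqnn 1) (sum_bool_le _)) _; rewrite card_ord; lia.
move=> v x s2 le vx vv S2.
have sH2 : stores_graph H s2 by apply: stores_graph_unchanged S2 sH1.
have vu2 : vars s2 vU = u by rewrite S2.1.
apply: wp_when (denotes_adj sH2 vu2 vv) _.
by case: (adj H u v) le => /= le; [apply: wp_bump le _ | rewrite addn0].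
Qed.

Lemma wp_count_smaller s u H : stores_graph H s -> vars s vU = u ->
  wp count_smaller (fun s' => vars s' vT = \sum_v (adj H u v && (v < u))) s.
Proof.
move=> sH vu; have poly := max_value_ge_poly.
apply: wp_seq; apply: (wp_assign (x := 0)) => //.
set s1 := set_var _ _ _; have sH1 : stores_graph H s1 by apply: stores_graph_set_var.
rewrite -[\sum_v _]add0n; apply: wp_sum => //; first by case: sH1 => /size_var.
  by apply: leq_trans (sum_bool_le _) _; rewrite card_ord; lia.
move=> v x s2 le vx vv S2.
have sH2 : stores_graph H s2 by apply: stores_graph_unchanged S2 sH1.
have vu2 : vars s2 vU = u by rewrite S2.1.
apply: wp_when (denotes_adj sH2 vu2 vv) _.
case: (adj H u v) le => /= le; last by rewrite addn0.
apply: wp_when (denotes_minus (denotes_var vu2) (denotes_var vv)) _.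
by rewrite subn_eq0 leqNgt; case: ltnP le => _ /= le; [apply: wp_bump le _ | rewrite addn0].
Qed.

Definition vertex_charge D H u := if component_min H u then D #|component H u| else 0.

Lemma sum_vertex_charge D H :
  \sum_u vertex_charge D H u = \sum_(S in components H) D #|S|.
Proof. by rewrite (sum_components_min H (fun S => D #|S|)) [RHS]big_mkcond. Qed.

Lemma sum_vertex_charge_le D H : best_table n D ->
  \sum_u vertex_charge D H u <= max_value.
Proof.
move=> best; apply: leq_trans max_value_ge_exp; apply: (@leq_trans (n * top)); last first.
  by rewrite leq_mul2r leqnSn orbT.
have -> : n * top = \sum_(u : V) top by rewrite sum_nat_const card_ord.
apply: leq_sum => u _; rewrite /vertex_charge; case: ifP => // _.
by apply: best_table_le_top best _; rewrite -[leqRHS](card_ord n) max_card.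
Qed.

Lemma wp_charge_vertex D s u x H : stores_graph H s -> cluster_graph H -> vars s vU = u ->
  arrays s aBest =1 D -> vars s vI = x -> x + vertex_charge D H u <= max_value ->
  wp charge_vertex (fun s' => vars s' vI = x + vertex_charge D H u) s.
Proof.
move=> sH cluster vu bestD vx le.
apply: wp_then (wp_count_component sH cluster vu) _ => s1 card_u S1.
have sH1 : stores_graph H s1 by apply: stores_graph_unchanged S1 sH.
have vu1 : vars s1 vU = u by rewrite S1.1.
apply: wp_then (wp_count_smaller sH1 vu1) _ => s2 smaller_u S2.
have [init2 _] : stores_graph H s2 by apply: stores_graph_unchanged S2 sH1.
have vx2 : vars s2 vI = x by rewrite S2.1 // S1.1.
apply: wp_unless (denotes_var smaller_u) _; rewrite smaller_neighbours_eq0 //.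
rewrite /vertex_charge in le *; case: ifP le => _ le; last by rewrite addn0.
apply: wp_bump vx2 _ le _ => //.
have card_u2 : vars s2 vJ = #|component H u| by rewrite S2.1.
split; last by rewrite /= card_u2 S2.2 // S1.2.
split=> //; apply: initialized_addressable; rewrite //= card_u2.
by have := max_card (component H u); rewrite card_ord /capacity; lia.
Qed.

Lemma wp_sum_best D s H : stores_graph H s -> cluster_graph H ->
  arrays s aBest =1 D -> best_table n D ->
  wp sum_best (fun s' => vars s' vI = \sum_(S in components H) D #|S|) s.
Proof.
move=> sH cluster bestD best; apply: wp_seq; apply: (wp_assign (x := 0)) => //.
set s1 := set_var _ _ _; have sH1 : stores_graph H s1 by apply: stores_graph_set_var.
rewrite -sum_vertex_charge -[\sum_u _]add0n; apply: wp_sum => //.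
- by case: sH1 => /size_var.
- exact: sum_vertex_charge_le.
move=> u x s2 le vx vu S2.
have sH2 : stores_graph H s2 by apply: stores_graph_unchanged S2 sH1.
by apply: wp_charge_vertex => // t; rewrite S2.2 //; apply: bestD.
Qed.

Definition accepts D x := leaf_cost D (branch k (start G x)) <= 2 * k.

Lemma wp_try_leaf D s x b : initialized s -> arrays s aBest =1 D -> best_table n D ->
  x < 2 ^ k -> vars s vLeaf = x -> vars s vAnswer = nat_of_bool b ->
  wp try_leaf (fun s' => vars s' vAnswer = (b || accepts D x)) s.
Proof.
move=> init bestD best ltx vx vb; have le_top := top_le_max.
apply: wp_seq; apply: (wp_assign (x := x)) => //; first lia.
apply: wp_seq; apply: (wp_assign (x := 0)) => //; set s1 := set_var vDeleted _ _.
have init1 : initialized s1 by do 2!apply: initialized_set_var => //.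
apply: wp_then (wp_copy init1) _ => s2 sG S2.
have rep2 : represents_node (start G x) s2.
  by split; rewrite // ?S2.1 //; apply: start_valid.
apply: wp_then (wp_run_branch rep2) _ => s3 [sH _ vd _] S3.
have bestD3 : arrays s3 aBest =1 D by move=> t; rewrite S3.2 // S2.2 //; apply: bestD.
have cluster := branch_cluster (start_valid G ltx).
apply: wp_then (wp_sum_best sH cluster bestD3 best) _ => s4 sum_H S4.
have [init4 _] : stores_graph (remaining (branch k (start G x))) s4.
  exact: stores_graph_unchanged S4 sH.
apply: (wp_unless (x := leaf_cost D (branch k (start G x)) - 2 * k)).
  by split; rewrite //= sum_H (S4.1 vDeleted) // vd (budget_var init4) !addnn -!mul2n.
rewrite subn_eq0 -/(accepts _ _); case: ifP => accept.
  by apply: (wp_assign (x := 1)) => //; [have := max_value_ge_poly; lia | rewrite accept orbT].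
by rewrite accept orbF S4.1 // S3.1 // S2.1.
Qed.

Lemma wp_solver : wp solver (fun s => vars s vAnswer = CCClusterDeletion G g1 g2 k) zero_state.
Proof.
apply: wp_then wp_initialize _ => s1 [init1 answer1 best1] _.
apply: wp_then (wp_make_best init1 best1) _ => s2 best S2.
have init2 : initialized s2 by apply: initialized_unchanged S2 init1.
set D := arrays s2 aBest in best.
apply: (wp_for (Inv := fun j s' => vars s' vAnswer = has (accepts D) (iota 0 j))).
- exact: power_var init2.
- by [].
- by rewrite S2.1.
- move=> x s3 ltx answer; set s4 := set_var vLeaf x s3 => S4.
  have init4 : initialized s4 by apply: initialized_unchanged S4 init2.
  have bestD4 : arrays s4 aBest =1 D by apply: S4.2.
  apply: wp_consequence (wp_try_leaf init4 bestD4 best ltx erefl answer) _ => s5 -> _.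
  by rewrite -[x.+1]addn1 iotaD has_cat /= orbF add0n.
move=> s3 answer _; rewrite /= answer; congr nat_of_bool.
have lt_top : 2 * k < top by have := budget_lt; lia.
rewrite -{1}(card_ord n) in best; have decides := branch_decides G lt_top best.
apply/hasP/idP => [[x]|/decides[x ltx accept]]; last by exists x; rewrite ?mem_iota.
by rewrite mem_iota => ltx accept; apply/decides; exists x.
Qed.

(** ** The compiled program *)

Lemma input_le a : inp a <= max_value.
Proof.
have poly := max_value_ge_poly; have le_top := top_le_max; have lt_k := budget_lt.
by case: a => [|[|[|[|a]]]] /=; lia.
Qed.

Lemma represents_input_memory : represents nvars narrays n max_value inp zero_state inp.
Proof.
have beyond_input a : (forall u v, a = 4 + (u * n + v) -> u = v) -> 4 <= a -> inp a = 0.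
  case: a => [|[|[|[|a]]]] // diagonal _; rewrite /input /=.
  apply/eqP; rewrite eqb0; apply/existsP=> -[u /existsP[v /andP[/eqP a_uv uv]]].
  by rewrite (diagonal u v) ?a_uv // adj_irrefl in uv.
split=> // [i _|a j _ _].
- by apply: (beyond_input (var_addr n i)) => // u v; apply: var_addr_diagonal.
- apply: (beyond_input (item_addr nvars n a j)) => // u v.
  by have := row_major_lt u v; rewrite /item_addr mulSn {1}/capacity; lia.
Qed.

Definition output := Store (Const 0) (Deref (var_expr vAnswer)).
Definition output_cost := (cost (Const 0) + cost (Deref (var_expr vAnswer))).+1.

Lemma solver_answers W :
  prog_weight solver * max_value.+1 <= W -> item_addr nvars n narrays 0 <= W ->
  answers (Seq (compile nvars solver) output) W
    (time_bound nvars max_iter solver + output_cost)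
    inp (CCClusterDeletion G g1 g2 k).
Proof.
move=> weight_le addr_le; have [safe_solver answer] := wp_solver.
have value_lt : max_value < W by apply: leq_trans weight_le; rewrite leq_pmull.
have [t [M [exec_solver t_le rep]]] := compile_sound (isT : 0 < nvars) erefl
  (fun a _ => input_le a) value_lt addr_le solver_wf weight_le safe_solver represents_input_memory.
have read_answer := evaluates_var (isT : 0 < nvars) erefl value_lt addr_le rep
  (isT : vAnswer < nvars).
exists (t + output_cost).
exists (update M 0 (vars (run inp solver zero_state) vAnswer)); split.
- apply: ExecSeq exec_solver _.
  exact: exec_store (evaluates_const M (leq0n W)) read_answer.
- by rewrite leq_add2r.
- by rewrite /update eqxx answer.
Qed.
End Solver.

Lemma output_cost_ge : 9 <= output_cost.
Proof. by vm_compute. Qed.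

Lemma solver_time_le n k c : time_bound nvars (fun=> 1) solver + output_cost <= c ->
  time_bound nvars (max_iter n k) solver + output_cost <= c * 2 ^ k * (n + 1) ^ c.
Proof.
set t1 := time_bound _ _ _ => c_ge; pose size := 2 ^ k * (n + 1) ^ c.
have size_gt0 : 0 < size by rewrite muln_gt0 !expn_gt0 addn1.
have iter_gt0 r : 0 < max_iter n k r by case: r; rewrite /max_iter ?expn_gt0.
have := time_bound_poly nvars solver iter_gt0; rewrite -/t1.
have -> : depth is_linear solver = 5 by vm_compute.
have -> : depth (predC is_linear) solver = 1 by vm_compute.
have iter_le : max_iter n k Linear ^ 5 * max_iter n k Exponential ^ 1 <= size.
  rewrite mulnC expn1 leq_mul // /max_iter addn1 leq_pexp2l //.
  have := leq_trans (leq_addl _ _) c_ge; have := output_cost_ge; lia.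
move=> t_le; rewrite -mulnA -/size.
apply: leq_trans (leq_mul c_ge (leqnn size)); rewrite mulnDl.
apply: leq_add (leq_pmulr _ size_gt0); apply: leq_trans t_le _.
exact: leq_mul (leqnn t1) iter_le.
Qed.

Lemma solver_word_bounds n g1 g2 k c : 9 <= c ->
  prog_weight solver * (max_value n g1 g2 k).+1 <= 2 ^ k * (n + g1 + g2 + 2) ^ c /\
  item_addr nvars n narrays 0 <= 2 ^ k * (n + g1 + g2 + 2) ^ c.
Proof.
set B := n + g1 + g2 + 2 => c_ge; have B_ge2 : 2 <= B by rewrite /B addn2.
have pow_gt0 : 0 < 2 ^ k by rewrite expn_gt0.
have le_word : 64 * max_value n g1 g2 k <= 2 ^ k * B ^ c.
  rewrite mulnCA leq_mul // -/B; apply: leq_trans (leq_pexp2l _ c_ge); last exact: ltnW.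
  by rewrite -[9]/(6 + 3) expnD leq_mul2r (@leq_exp2r 2 B 6) // B_ge2 orbT.
split; apply: leq_trans le_word.
  have : 0 < max_value n g1 g2 k by rewrite muln_gt0 pow_gt0 expn_gt0 addn2.
  have -> : prog_weight solver = 10 by vm_compute.
  lia.
rewrite /item_addr /capacity /nvars /narrays /max_value -/B.
apply: leq_trans (leq_mul (leqnn 64) (leq_pmull (B ^ 3) pow_gt0)).
by rewrite !expnS expn0 /B; nia.
Qed.

Theorem mainTheorem13 :
  exists (P : cmd) (c : nat),
    forall (n g1 g2 k : nat) (G : graph 'I_n),
      answers P (2 ^ k * (n + g1 + g2 + 2) ^ c) (c * 2 ^ k * (n + 1) ^ c)
        (input G g1 g2 k) (CCClusterDeletion G g1 g2 k).
Proof.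
pose c := time_bound nvars (fun=> 1) solver + output_cost.
exists (Seq (compile nvars solver) output), c => n g1 g2 k G.
have c_ge9 : 9 <= c := leq_trans output_cost_ge (leq_addl _ _).
have [weight_le addr_le] := solver_word_bounds n g1 g2 k c_ge9.
have [t [M [exec_P t_le answer]]] := solver_answers G weight_le addr_le.
by exists t, M; split=> //; apply: leq_trans t_le (solver_time_le _ _ (leqnn c)).
Qed.
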